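(* Let $\mathcal{C}:\mathbf{R}\to\prod_{\gamma\in\Gamma}\mathbf{Q}_\gamma$ be a $\Gamma$-coloring of a ranked category $(\mathbf{R},r)$ with components $(\mathbf{Q}_\gamma,r_\gamma)$. If, for all $\gamma\in\Gamma$, the category $\mathbf{Q}_\gamma$ admits finite colimits, then the multicolored bottleneck distance is bounded by the interleaving distance, i.e. for all tame $(\mathbb{R},\le)$-indexed diagrams $F,G$ in $\mathbf{R}$, $$d_{\mathbf{R}}(F,G)\ \ge\ d_{\mathcal{C}}(\mathcal{D}F,\mathcal{D}G).$$ Furthermore, if all $(\mathbf{Q}_\gamma,r_\gamma)$ are tight, then $\mathcal{C}$ is a tight coloring, i.e. $d_{\mathbf{R}}(F,G)=d_{\mathcal{C}}(\mathcal{D}F,\mathcal{D}G)$ for all tame $(\mathbb{R},\le)$-indexed diagrams $F,G$ in $\mathbf{R}$.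
   Context: Ranked category: a regular category $\mathbf{R}$ (in which every morphism factors as a regular epimorphism onto its image followed by a monomorphism) with a rank function, i.e. a lower-bounded $r:\mathrm{Obj}(\mathbf{R})\to\mathbb{Z}$ such that: (1) $r(A)\le r(B)$ for any monomorphism $A\hookrightarrow B$; (2) $r(B)\ge r(D)$ for any regular epimorphism $B\twoheadrightarrow D$; (3) for any pullback square with monomorphisms $A\hookrightarrow B$, $C\hookrightarrow D$ and regular epimorphisms $A\twoheadrightarrow C$, $B\twoheadrightarrow D$, $r(B)-r(A)\ge r(D)-r(C)$. $\Gamma$-coloring: given an index set $\Gamma$, ranked categories $(\mathbf{Q}_\gamma,r_\gamma)$ and functors $\mathcal{C}_\gamma:\mathbf{R}\to\mathbf{Q}_\gamma$ ($\gamma\in\Gamma$) preserving the image factorization (i.e. monomorphisms and regular epimorphisms) such that (1) the induced functor $\mathcal{C}:\mathbf{R}\to\prod_{\gamma}\mathbf{Q}_\gamma$ is fully faithful; (2) for each object $X$ of $\mathbf{R}$, $r_\gamma(\mathcal{C}_\gamma(X))=0$ for all but finitely many $\gamma$, and $r(X)=\sum_{\gamma}r_\gamma(\mathcal{C}_\gamma(X))$. For a functor $F:(\mathbb{R},\le)\to\mathbf{R}$ into a ranked category $(\mathbf{R},r)$ (an $(\mathbb{R},\le)$-indexed diagram), put $p_F(u,v)=r(\mathrm{im}(F(u\le v)))$ for real $u\le v$. $F$ is constant on an interval $I$ if $p_F(a,a)=p_F(a,b)=p_F(b,b)$ for all $a\le b$ in $I$; $a\in\mathbb{R}$ is a regular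 value if $F$ is constant on some connected neighborhood of $a$, critical otherwise; $F$ is tame if it has finitely many critical values. Multiplicity: for $u<v$ in $\mathbb{R}\cup\{-\infty,+\infty\}$, $\mu(u,v)$ is the minimum, over disjoint connected neighborhoods $I_u,I_v$ of $u$ and $v$, of $$p_F(\sup I_u,\inf I_v)-p_F(\inf I_u,\inf I_v)-p_F(\sup I_u,\sup I_v)+p_F(\inf I_u,\sup I_v),$$ with the convention that $p_F(u,v)=\min_{x\le y\in\mathbb{R}}p_F(x,y)$ whenever $u$ or $v$ is not finite. If $\mu(u,v)>0$, $(u,v)$ is a cornerpoint. The persistence diagram $\mathcal{D}F$ is the multiset of cornerpoints (with multiplicity $\mu$), along with all diagonal points $(u,u)$, $u\in\mathbb{R}$, each with countably infinite multiplicity. The bottleneck distance is $d(\mathcal{D}F,\mathcal{D}G)=\inf_{\beta}\sup_{q\in\mathcal{D}F}\|q-\beta(q)\|_\infty$ over all bijections $\beta:\mathcal{D}F\to\mathcal{D}G$ (equal infinite coordinates are at distance $0$, a finite and an infinite coordinate, or two different infinite ones, at distance $\infty$). Interleaving distance: let $T_b(a)=a+b$ on $(\mathbb{R},\le)$ and, for $b\ge0$, $\eta_b:\mathrm{Id}\to T_b$ the natural transformation $a\le a+b$. For $\epsilon\ge0$, $F,G$ are $\epsilon$-interleaved if there are natural transformations $\phi^F:F\to GT_\epsilon$, $\phi^G:G\to FT_\epsilon$ with $(\phi^GT_\epsilon)\phi^F=F\eta_{2\epsilon}$ and $(\phi^FT_\epsilon)\phi^G=G\eta_{2\epsilon}$.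 The interleaving distance $d_{\mathbf{R}}(F,G)$ is the infimum of such $\epsilon$ ($\infty$ if there are none). A ranked category $(\mathbf{Q},r)$ is tight if $d_{\mathbf{Q}}(F,G)=d(\mathcal{D}F,\mathcal{D}G)$ for all tame $(\mathbb{R},\le)$-indexed diagrams $F,G$ in $\mathbf{Q}$. Multicolored diagrams: for a colored ranked category, the multicolored persistence diagram of a tame $F$ is the superposition of the persistence diagrams $\mathcal{D}(\mathcal{C}_\gamma F)$ (computed with $r_\gamma$), the points of $\mathcal{D}(\mathcal{C}_\gamma F)$ having color $\gamma$. The multicolored bottleneck distance $d_{\mathcal{C}}(\mathcal{D}F,\mathcal{D}G)$ is defined like the bottleneck distance, but only allowing bijections that preserve the color of points. *)

(* Defs.v *)
From HB Require Import structures.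
From mathcomp Require Import all_boot all_order all_algebra.
From mathcomp Require Import all_classical all_reals all_analysis.

Set Implicit Arguments.
Unset Strict Implicit.
Unset Printing Implicit Defensive.

Import Order.TTheory GRing.Theory Num.Theory.
Import numFieldNormedType.Exports.

Local Open Scope classical_set_scope.
Local Open Scope ring_scope.

Record category := Category {
  obj :> Type;
  hom : obj -> obj -> Type;
  idm : forall X, hom X X;
  comp : forall X Y Z, hom Y Z -> hom X Y -> hom X Z;
  comp1m : forall X Y (f : hom X Y), comp (idm Y) f = f;
  compm1 : forall X Y (f : hom X Y), comp f (idm X) = f;
  compmA : forall X Y Z W (h : hom Z W) (g : hom Y Z) (f : hom X Y),
    comp h (comp g f) = comp (comp h g) f }.
Arguments hom {c} _ _.
Arguments idm {c} X.

Declare Scope cat_scope.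
Delimit Scope cat_scope with cat.
Notation "g \c f" := (comp g f) (at level 40, left associativity) : cat_scope.
Local Open Scope cat_scope.

Record functor (C D : category) := Functor {
  fobj :> C -> D;
  fmap : forall X Y : C, hom X Y -> hom (fobj X) (fobj Y);
  fmap1 : forall X : C, fmap (idm X) = idm (fobj X);
  fmapM : forall (X Y Z : C) (g : hom Y Z) (f : hom X Y),
    fmap (g \c f) = fmap g \c fmap f }.

Lemma fcomp1 (C D E : category) (G : functor D E) (F : functor C D) (X : C) :
  fmap G (fmap F (idm X)) = idm (G (F X)).
Proof. by rewrite !fmap1. Qed.

Lemma fcompM (C D E : category) (G : functor D E) (F : functor C D)
    (X Y Z : C) (g : hom Y Z) (f : hom X Y) :
  fmap G (fmap F (g \c f)) = fmap G (fmap F g) \c fmap G (fmap F f).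
Proof. by rewrite !fmapM. Qed.

Definition fcomp (C D E : category) (G : functor D E) (F : functor C D) :
    functor C E :=
  @Functor C E (fun X => G (F X)) (fun X Y f => fmap G (fmap F f))
    (fcomp1 G F) (fcompM G F).

Record nat_trans (C D : category) (F G : functor C D) := NatTrans {
  ncomp :> forall X : C, hom (F X) (G X);
  ncompP : forall (X Y : C) (f : hom X Y),
    fmap G f \c ncomp X = ncomp Y \c fmap F f }.

Definition fully_faithful (C D : category) (F : functor C D) : Prop :=
  forall X Y : C, bijective (@fmap C D F X Y).

Section ProductCategory.
Variables (I : Type) (Q : I -> category).

Let pobj : Type := forall i, Q i.
Let phom (X Y : pobj) : Type := forall i, hom (X i) (Y i).
Let pid (X : pobj) : phom X X := fun i => idm (X i).
Let pcomp (X Y Z : pobj) (g : phom Y Z) (f : phom X Y) : phom X Z :=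
  fun i => g i \c f i.

Lemma pcomp1m (X Y : pobj) (f : phom X Y) : pcomp (pid Y) f = f.
Proof. by apply: functional_extensionality_dep => i; apply: comp1m. Qed.

Lemma pcompm1 (X Y : pobj) (f : phom X Y) : pcomp f (pid X) = f.
Proof. by apply: functional_extensionality_dep => i; apply: compm1. Qed.

Lemma pcompmA (X Y Z W : pobj) (h : phom Z W) (g : phom Y Z) (f : phom X Y) :
  pcomp h (pcomp g f) = pcomp (pcomp h g) f.
Proof. by apply: functional_extensionality_dep => i; apply: compmA. Qed.

Definition prod_cat : category :=
  @Category pobj phom pid pcomp pcomp1m pcompm1 pcompmA.

Variables (C : category) (F : forall i, functor C (Q i)).

Let tobj (X : C) : prod_cat := fun i => F i X.
Let tmap (X Y : C) (f : hom X Y) : hom (tobj X) (tobj Y) :=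
  fun i => fmap (F i) f.

Lemma ftuple1 (X : C) : tmap (idm X) = idm (tobj X).
Proof. by apply: functional_extensionality_dep => i; apply: fmap1. Qed.

Lemma ftupleM (X Y Z : C) (g : hom Y Z) (f : hom X Y) :
  tmap (g \c f) = tmap g \c tmap f.
Proof. by apply: functional_extensionality_dep => i; apply: fmapM. Qed.

Definition ftuple : functor C prod_cat :=
  @Functor C prod_cat tobj tmap ftuple1 ftupleM.

End ProductCategory.

Section ThinCategory.
Variables (T : Type) (le : rel T).
Hypotheses (le_refl : reflexive le) (le_trans : transitive le).

Let tcomp (x y z : T) (h : le y z) (g : le x y) : le x z := le_trans g h.

Definition thin_cat : category :=
  @Category T (fun x y => le x y : Type) (fun x => le_refl x) tcomp
    (fun x y f => bool_irrelevance _ _) (fun x y f => bool_irrelevance _ _)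
    (fun x y z w h g f => bool_irrelevance _ _).

End ThinCategory.

Definition finite_category (J : category) : Prop :=
  finite_set [set: J] /\ forall i j : J, finite_set [set: hom i j].

Section Limits.
Variables (J C : category) (D : functor J C).

Definition is_cone (X : C) (p : forall j : J, hom X (D j)) : Prop :=
  forall (i j : J) (f : hom i j), fmap D f \c p i = p j.

Definition is_limit (L : C) (p : forall j : J, hom L (D j)) : Prop :=
  is_cone p /\
  forall (X : C) (q : forall j : J, hom X (D j)), is_cone q ->
    exists! u : hom X L, forall j, p j \c u = q j.

Definition is_cocone (X : C) (p : forall j : J, hom (D j) X) : Prop :=
  forall (i j : J) (f : hom i j), p j \c fmap D f = p i.

Definition is_colimit (L : C) (p : forall j : J, hom (D j) L) : Prop :=
  is_cocone p /\
  forall (X : C) (q : forall j : J, hom (D j) X), is_cocone q ->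
    exists! u : hom L X, forall j, u \c p j = q j.

End Limits.

Definition has_finite_limits (C : category) : Prop :=
  forall (J : category) (D : functor J C), finite_category J ->
    exists (L : C) (p : forall j : J, hom L (D j)), is_limit p.

Definition has_finite_colimits (C : category) : Prop :=
  forall (J : category) (D : functor J C), finite_category J ->
    exists (L : C) (p : forall j : J, hom (D j) L), is_colimit p.

Section Morphisms.
Variable C : category.

Definition mono (X Y : C) (f : hom X Y) : Prop :=
  forall (Z : C) (g h : hom Z X), f \c g = f \c h -> g = h.

Definition is_coequalizer (X Y Q : C) (f g : hom X Y) (q : hom Y Q) : Prop :=
  q \c f = q \c g /\
  forall (Z : C) (h : hom Y Z), h \c f = h \c g ->
    exists! u : hom Q Z, u \c q = h.

Definition regular_epi (Y Q : C) (q : hom Y Q) : Prop :=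
  exists (X : C) (f g : hom X Y), is_coequalizer f g q.

(* The square [f \c p = g \c q] is a pullback:
<<
     P --q--> Y
     |p       |g
     X --f--> Z
>> *)
Definition is_pullback (P X Y Z : C)
    (p : hom P X) (q : hom P Y) (f : hom X Z) (g : hom Y Z) : Prop :=
  f \c p = g \c q /\
  forall (W : C) (a : hom W X) (b : hom W Y), f \c a = g \c b ->
    exists! u : hom W P, p \c u = a /\ q \c u = b.

Definition regular_category : Prop :=
  [/\ has_finite_limits C,
      forall (K X Y : C) (p q : hom K X) (f : hom X Y), is_pullback p q f f ->
        exists (Q : C) (e : hom X Q), is_coequalizer p q e &
      forall (P X Y Z : C) (p : hom P X) (q : hom P Y) (f : hom X Z)
        (g : hom Y Z), is_pullback p q f g -> regular_epi g -> regular_epi p].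

Definition is_image (X Y : C) (f : hom X Y) (I : C) : Prop :=
  exists (e : hom X I) (m : hom I Y), [/\ regular_epi e, mono m & m \c e = f].

End Morphisms.

Section Cospan.
Variables (C : category) (X Y Z : C) (f : hom X Z) (g : hom Y Z).

(* [None] is the apex of the cospan, [Some true] and [Some false] its feet. *)
Let cle : rel (option bool) := fun i j => (i == j) || (j == None).

Lemma cle_refl : reflexive cle.
Proof. by move=> i; rewrite /cle eqxx. Qed.

Lemma cle_trans : transitive cle.
Proof. by move=> [[]|] [[]|] [[]|]. Qed.

Let J := thin_cat cle_refl cle_trans.

Lemma finite_cospan : finite_category J.
Proof.
split=> [|i j]; first exact: (@finite_finset (option bool)).
have [[h _]|no] := pselect ([set: @hom J i j] !=set0).
  apply: (sub_finite_set _ (finite_set1 h)) => k _ /=.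
  exact: bool_irrelevance.
suff -> : [set: @hom J i j] = set0 by exact: finite_set0.
by rewrite -subset0 => h _; apply: no; exists h.
Qed.

Let dobj (i : option bool) : C :=
  match i with None => Z | Some true => X | Some false => Y end.

Let dmap (i j : option bool) : cle i j -> hom (dobj i) (dobj j) :=
  match i, j return cle i j -> hom (dobj i) (dobj j) with
  | Some true, Some true => fun=> idm X
  | Some true, None => fun=> f
  | Some false, Some false => fun=> idm Y
  | Some false, None => fun=> g
  | None, None => fun=> idm Z
  | _, _ => fun abs => False_rect _ (notF abs)
  end.

Lemma dmap1 (i : J) : dmap (@idm J i) = idm (dobj i).
Proof. by case: i => [[]|]. Qed.

Lemma dmapM (i j k : J) (b : hom j k) (a : hom i j) :
  dmap (b \c a) = dmap b \c dmap a.
Proof.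
case: i a => [[]|]; case: j b => [[]|]; case: k => [[]|] //= b a;
  by rewrite ?comp1m ?compm1.
Qed.

Definition cospan : functor J C := @Functor J C dobj dmap dmap1 dmapM.

Lemma pullback_ex : has_finite_limits C ->
  exists (P : C) (p : hom P X) (q : hom P Y), is_pullback p q f g.
Proof.
move=> /(_ J cospan finite_cospan)[P [p [cone_p lim_p]]].
have pf : f \c p (Some true) = p None by exact: (cone_p (Some true) None isT).
have pg : g \c p (Some false) = p None by exact: (cone_p (Some false) None isT).
exists P, (p (Some true)), (p (Some false)); split; first by rewrite pf pg.
move=> W a b fagb.
pose q (j : J) : hom W (cospan j) :=
  match j as j return hom W (dobj j) with
  | None => f \c a | Some true => a | Some false => b
  end.
have cone_q : is_cone q.
  by move=> [[]|] [[]|] //= h; rewrite ?comp1m.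
have [u [uq uniq_u]] := lim_p W q cone_q; exists u; split.
  by split; [exact: (uq (Some true))|exact: (uq (Some false))].
move=> v [va vb]; apply: uniq_u => -[[]|] //=.
by rewrite -pf -compmA va.
Qed.

End Cospan.

Lemma regular_epi_epi (C : category) (Y Q Z : C) (e : hom Y Q)
    (g h : hom Q Z) : regular_epi e -> g \c e = h \c e -> g = h.
Proof.
move=> [X [a [b [eab univ]]]] gh.
have gab : (g \c e) \c a = (g \c e) \c b by rewrite -!compmA eab.
have [u [_ uniq_u]] := univ Z (g \c e) gab.
by rewrite -(uniq_u g)// -(uniq_u h).
Qed.

Lemma image_ex (C : category) (X Y : C) (f : hom X Y) :
  regular_category C -> exists I, is_image f I.
Proof.
move=> [lims coeqs stab].
have [K [p [q pb]]] := pullback_ex f f lims.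
have [I [e coeq_e]] := coeqs _ _ _ _ _ _ pb.
have repi_e : regular_epi e by exists K, p, q.
have [m [me _]] := coeq_e.2 Y f pb.1.
exists I, e, m; split=> // T a b mab.
have [T1 [e1 [x pb1]]] := pullback_ex a e lims.
have repi1 := stab _ _ _ _ _ _ _ _ pb1 repi_e.
have [T2 [e2 [y pb2]]] := pullback_ex (b \c e1) e lims.
have repi2 := stab _ _ _ _ _ _ _ _ pb2 repi_e.
have [w [[pw qw] _]] : exists! w, p \c w = x \c e2 /\ q \c w = y.
  apply: pb.2.
  by rewrite -me -!compmA -pb2.1 !compmA -[m \c e \c x]compmA -pb1.1
             !compmA mab.
apply: (regular_epi_epi repi1); apply: (regular_epi_epi repi2).
by rewrite pb1.1 pb2.1 -compmA -pw -qw !compmA coeq_e.1.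
Qed.

Record ranked_category := RankedCategory {
  rcat :> category;
  rcat_regular : regular_category rcat;
  rank : rcat -> int;
  rank_lower_bounded : exists m : int, forall A : rcat, m <= rank A;
  rank_mono : forall (A B : rcat) (i : hom A B), mono i -> rank A <= rank B;
  rank_regular_epi : forall (B D : rcat) (e : hom B D), regular_epi e ->
    rank D <= rank B;
  rank_pullback : forall (A B C D : rcat) (i : hom A B) (e : hom A C)
      (e' : hom B D) (j : hom C D),
    mono i -> mono j -> regular_epi e -> regular_epi e' ->
    is_pullback i e e' j -> rank D - rank C <= rank B - rank A }.
Arguments rank {r} A.

Definition image (C : ranked_category) (X Y : C) (f : hom X Y) : C :=
  sval (cid (image_ex f (rcat_regular C))).

Record coloring (Gamma : choiceType) (C : ranked_category)
    (Q : Gamma -> ranked_category) := Coloring {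
  color : forall g : Gamma, functor C (Q g);
  color_mono : forall (g : Gamma) (X Y : C) (f : hom X Y),
    mono f -> mono (fmap (color g) f);
  color_regular_epi : forall (g : Gamma) (X Y : C) (f : hom X Y),
    regular_epi f -> regular_epi (fmap (color g) f);
  color_fully_faithful : fully_faithful (ftuple color);
  color_finite : forall X : C,
    finite_set [set g : Gamma | rank (color g X) != 0];
  color_rank : forall X : C,
    rank X = \sum_(g \in [set: Gamma]) rank (color g X) }.

Section Diagrams.
Variable R : realType.

Definition real_cat : category := thin_cat (@le_refl _ R) (@le_trans _ R).

Lemma shift_mono (b : R) (x y : R) : x <= y -> x + b <= y + b.
Proof. by rewrite lerD2r. Qed.

Definition shift (b : R) : functor real_cat real_cat :=
  @Functor real_cat real_cat (fun x : R => x + b) (shift_mono b)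
    (fun x => bool_irrelevance _ _) (fun x y z g f => bool_irrelevance _ _).

(* [fmap F h] with [h : a <= a + e + e] is the component at [a] of [F eta_{2e}],
   [T_e T_e] being identified with [T_{2e}]. *)
Definition interleaved (C : category) (e : R) (F G : functor real_cat C) :
    Prop :=
  exists (phiF : nat_trans F (fcomp G (shift e)))
         (phiG : nat_trans G (fcomp F (shift e))),
    (forall (a : R) (h : a <= a + e + e),
       phiG (a + e) \c phiF a = @fmap _ _ F a (a + e + e) h) /\
    (forall (a : R) (h : a <= a + e + e),
       phiF (a + e) \c phiG a = @fmap _ _ G a (a + e + e) h).

Definition interleaving_dist (C : category) (F G : functor real_cat C) :
    \bar R :=
  ereal_inf [set e%:E | e in [set e : R | 0 <= e /\ interleaved e F G]].

(* [0] if the minimum does not exist. *)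
Definition int_min (A : set int) : int :=
  xget 0 [set m | A m /\ forall n, A n -> m <= n].

Section Persistence.
Variables (C : ranked_category) (F : functor real_cat C).

(* Only meaningful for [u <= v]; [0] otherwise. *)
Definition prank (u v : R) : int :=
  if pselect (u <= v) is left h then rank (image (@fmap _ _ F u v h)) else 0.

Definition eprank (u v : \bar R) : int :=
  match u, v with
  | u%:E, v%:E => prank u v
  | _, _ => int_min [set n | exists x y : R, (x <= y)%R /\ n = prank x y]
  end%E.

Definition constant_on (I : set R) : Prop :=
  forall a b : R, I a -> I b -> a <= b ->
    prank a a = prank a b /\ prank a b = prank b b.

Definition regular_value (a : R) : Prop :=
  exists I : set R, [/\ nbhs a I, connected I & constant_on I].

Definition tame : Prop := finite_set [set a : R | ~ regular_value a].

(* Neighborhoods are taken in the extended real line. *)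
Definition multiplicity (u v : \bar R) : int :=
  int_min [set n | exists Iu Iv : set (\bar R),
    [/\ nbhs u Iu /\ connected Iu, nbhs v Iv /\ connected Iv,
        Iu `&` Iv = set0 &
        n = eprank (ereal_sup Iu) (ereal_inf Iv)
            - eprank (ereal_inf Iu) (ereal_inf Iv)
            - eprank (ereal_sup Iu) (ereal_sup Iv)
            + eprank (ereal_inf Iu) (ereal_sup Iv)]].

(* A multiset of points is encoded as the set of pairs (point, index of the
   copy), so that a bijection between multisets is a bijection of sets. *)
Definition diagram : set (\bar R * \bar R * nat) :=
  [set q | (q.1.1 < q.1.2)%E /\ q.2%:Z < multiplicity q.1.1 q.1.2] `|`
  [set q | exists u : R, q.1 = (u%:E, u%:E)].

End Persistence.

Definition coord_dist (x y : \bar R) : \bar R :=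
  match x, y with
  | x%:E, y%:E => `|x - y|%R%:E
  | +oo, +oo => 0
  | -oo, -oo => 0
  | _, _ => +oo
  end%E.

Definition point_dist (p q : \bar R * \bar R) : \bar R :=
  Order.max (coord_dist p.1 q.1) (coord_dist p.2 q.2).

(* Suprema are taken in [[0, +oo]]: adding [0] only matters when [A] is empty,
   since [ereal_sup set0 = -oo]. *)
Definition matching_cost (T : Type) (pos : T -> \bar R * \bar R) (A : set T)
    (beta : T -> T) : \bar R :=
  ereal_sup (0%E |` [set point_dist (pos q) (pos (beta q)) | q in A]).

Definition bottleneck_dist (C : ranked_category) (F G : functor real_cat C) :
    \bar R :=
  ereal_inf [set matching_cost fst (diagram F) beta | beta in
    [set beta | set_bij (diagram F) (diagram G) beta]].

Definition tight (C : ranked_category) : Prop :=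
  forall F G : functor real_cat C, tame F -> tame G ->
    interleaving_dist F G = bottleneck_dist F G.

Section Multicolored.
Variables (Gamma : choiceType) (C : ranked_category).
Variables (Q : Gamma -> ranked_category) (c : coloring C Q).

Definition multidiagram (F : functor real_cat C) :
    set (Gamma * (\bar R * \bar R * nat)) :=
  [set q | diagram (fcomp (color c q.1) F) q.2].

Definition multi_bottleneck_dist (F G : functor real_cat C) : \bar R :=
  ereal_inf [set matching_cost (fun q => q.2.1) (multidiagram F) beta | beta in
    [set beta | set_bij (multidiagram F) (multidiagram G) beta /\
                forall q, multidiagram F q -> (beta q).1 = q.1]].

Definition tight_coloring : Prop :=
  forall F G : functor real_cat C, tame F -> tame G ->
    interleaving_dist F G = multi_bottleneck_dist F G.

End Multicolored.
End Diagrams.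

(* Main.v *)
(* Stability of each color.  An [e]-interleaving of [F] and [G] glues them into
   a diagram indexed by a poset containing two copies of the reals; its left
   Kan extension is a functor [H] on the plane whose value at [(x, y)] is the
   colimit of the [F s] with [s <= x] and the [G s] with [s <= y].  A four-object
   subdiagram is cofinal, so finite colimits suffice.  [H (x, y)] is [F x] for
   [y <= x - e] and [G y] for [x <= y - e].  Take a grid of step [d = e / N] so
   fine that every cell contains at most one critical value.  The sequences
   [H (z_i, z_(i + t - N))], for [t = 0, ..., 2 N], lead from [F] to [G], and two
   consecutive ones are the even and the odd terms of a single staircase
   sequence.  Multiplicities, second differences of ranks, are nonnegative (this
   is where the pullback axiom enters) and additive under refinement, so passing
   from even to odd terms matches the points of the two diagrams up to half a
   grid step, except those next to the diagonal.  Composing the [2 N] matchings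
   yields an injection of cost [e + d] from the diagram of [F] into that of [G]
   with its diagonal; a pointwise Cantor-Bernstein argument turns two such
   injections into a bijection.  No interpolating diagram needs to be tame.

   The bounds for the colors combine because rank equality in the total category
   forces rank equality in every color.  For tight colors, interleavings with a
   common parameter in every color lift by full faithfulness. *)
From Pilot Require Import Defs.
From mathcomp Require Import all_boot all_order all_algebra.
From mathcomp Require Import all_classical all_reals all_analysis.
From mathcomp Require Import zify ring lra.
(* Imported again because [mathcomp] shadows [hom]. *)
Import Pilot.Defs.

Set Implicit Arguments.
Unset Strict Implicit.
Unset Printing Implicit Defensive.

Import Order.TTheory GRing.Theory Num.Theory.
Import numFieldNormedType.Exports.

Local Open Scope classical_set_scope.
Local Open Scope ring_scope.
Local Open Scope cat_scope.

(** * Images and ranks *)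

Lemma regular_epi_fill (C : category) (X I Y Z : C) (e : hom X I)
    (m : hom Y Z) (u : hom X Y) (v : hom I Z) :
  regular_epi e -> mono m -> m \c u = v \c e ->
  exists w : hom I Y, w \c e = u /\ m \c w = v.
Proof.
move=> re mm muve; have [W [f [g [efg univ]]]] := re.
have [|w [we _]] := univ _ u.
  by apply: mm; rewrite !compmA muve -!compmA efg.
exists w; split=> //; apply: (regular_epi_epi re).
by rewrite -compmA we.
Qed.

(** The diagonal filler is a section of the mono part [m] of the image of [g], so [m] is invertible
    and [g] coequalizes the same pair as [e']. *)
Lemma regular_epi_cancel (C : category) (X Y Z : C) (e : hom X Y)
    (g : hom Y Z) :
  regular_category C -> regular_epi (g \c e) -> regular_epi g.
Proof.
move=> regC rge; have [I [e' [m [re' mm me']]]] := image_ex g regC.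
have [w [_ mw]] : exists w, w \c (g \c e) = e' \c e /\ m \c w = idm Z.
  by apply: regular_epi_fill => //; rewrite comp1m compmA me'.
have wm : w \c m = idm I by apply: mm; rewrite compmA mw comp1m compm1.
have [W [a [b [eab univ]]]] := re'.
exists W, a, b; split; first by rewrite -me' -!compmA eab.
move=> T h hab; have [u [ue' uniq_u]] := univ T h hab.
exists (u \c w); split.
  by rewrite -me' compmA -[u \c w \c m]compmA wm compm1.
move=> v vg; rewrite (uniq_u (v \c m)); last by rewrite -compmA me'.
by rewrite -compmA mw compm1.
Qed.

Lemma mono_cancel (C : category) (X Y Z : C) (f : hom X Y) (g : hom Y Z) :
  mono (g \c f) -> mono f.
Proof. by move=> mgf T a b fab; apply: mgf; rewrite -!compmA fab. Qed.

Section RankImage.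
Variable C : ranked_category.
Implicit Types X Y Z W : C.

Lemma imageP X Y (f : hom X Y) : is_image f (image f).
Proof. exact: svalP (cid _). Qed.

Lemma rank_is_image_le X Y (f : hom X Y) (I J : C) :
  is_image f I -> is_image f J -> rank I <= rank J.
Proof.
move=> [e [m [re mm me]]] [e' [m' [re' mm' me']]].
have [w [_ m'w]] : exists w, w \c e = e' /\ m' \c w = m.
  by apply: regular_epi_fill => //; rewrite me me'.
by apply: (@rank_mono _ _ _ w); apply: (@mono_cancel _ _ _ _ _ m'); rewrite m'w.
Qed.

Lemma rank_imageE X Y (f : hom X Y) (I : C) :
  is_image f I -> rank (image f) = rank I.
Proof.
move=> fI; apply/le_anti/andP; split;
  by apply: rank_is_image_le; eauto; apply: imageP.
Qed.

(** The images of [g \c f], [g], [h \c g \c f] and [h \c g] form a commutative square of monos and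
    regular epis that need not be a pullback. The rank axiom is applied to the pullback [P] of [d]
    and [j] instead; the image of [g \c f] embeds into [P], so its rank is at most that of [P]. *)
Lemma rank_image_box X Y Z W (f : hom X Y) (g : hom Y Z) (h : hom Z W) :
  rank (image (h \c g)) - rank (image (h \c g \c f)) <=
  rank (image g) - rank (image (g \c f)).
Proof.
have [e1 [m1 [re1 mm1 me1]]] := imageP g.
have [e2 [m2 [re2 mm2 me2]]] := imageP (g \c f).
have [e3 [m3 [re3 mm3 me3]]] := imageP (h \c g).
have [e4 [m4 [re4 mm4 me4]]] := imageP (h \c g \c f).
have [i [ie2 m1i]] : exists i, i \c e2 = e1 \c f /\ m1 \c i = m2.
  by apply: regular_epi_fill => //; rewrite compmA me1 me2.
have [j [je4 m3j]] : exists j, j \c e4 = e3 \c f /\ m3 \c j = m4.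
  by apply: regular_epi_fill => //; rewrite compmA me3 me4.
have [d [de1 m3d]] : exists d, d \c e1 = e3 /\ m3 \c d = h \c m1.
  by apply: regular_epi_fill => //; rewrite me3 -compmA me1.
have [b [be2 m4b]] : exists b, b \c e2 = e4 /\ m4 \c b = h \c m2.
  by apply: regular_epi_fill => //; rewrite me4 -!compmA me2.
have rd : regular_epi d.
  by apply: (@regular_epi_cancel _ _ _ _ e1 d (rcat_regular C)); rewrite de1.
have mj : mono j by apply: (@mono_cancel _ _ _ _ _ m3); rewrite m3j.
have mi : mono i by apply: (@mono_cancel _ _ _ _ _ m1); rewrite m1i.
have [lims _ _] := rcat_regular C.
have [P [p [q pb]]] := pullback_ex d j lims.
have dijb : d \c i = j \c b.
  by apply: mm3; rewrite !compmA m3d m3j -compmA m1i m4b.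
have [w [[pw qw] _]] := pb.2 _ _ _ dijb.
have mp : mono p.
  move=> T x y pxy; have : q \c x = q \c y.
    by apply: mj; rewrite !compmA -pb.1 -!compmA pxy.
  move=> qxy; have [t [_ uniq_t]] := pb.2 _ (p \c x) (q \c x)
    ltac:(by rewrite !compmA pb.1).
  by rewrite -(uniq_t x)// -(uniq_t y).
have rq : regular_epi q.
  apply: (@regular_epi_cancel _ _ _ _ w q (rcat_regular C)); rewrite qw.
  by apply: (@regular_epi_cancel _ _ _ _ e2 b (rcat_regular C)); rewrite be2.
have mw : mono w by apply: (@mono_cancel _ _ _ _ _ p); rewrite pw.
apply: le_trans (rank_pullback mp mj rq rd pb) _.
by rewrite lerD2l lerN2; apply: rank_mono mw.
Qed.

Lemma rank_image_compr X Y Z (f : hom X Y) (g : hom Y Z) :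
  rank (image (g \c f)) <= rank (image g).
Proof.
have [e1 [m1 [re1 mm1 me1]]] := imageP g.
have [e2 [m2 [re2 mm2 me2]]] := imageP (g \c f).
have [i [ie2 m1i]] : exists i, i \c e2 = e1 \c f /\ m1 \c i = m2.
  by apply: regular_epi_fill => //; rewrite compmA me1 me2.
by apply: (@rank_mono _ _ _ i); apply: (@mono_cancel _ _ _ _ _ m1); rewrite m1i.
Qed.

Lemma rank_image_compl X Y Z (f : hom X Y) (g : hom Y Z) :
  rank (image (g \c f)) <= rank (image f).
Proof.
have [e1 [m1 [re1 mm1 me1]]] := imageP f.
have [e2 [m2 [re2 mm2 me2]]] := imageP (g \c f).
have [b [be1 _]] : exists b, b \c e1 = e2 /\ m2 \c b = g \c m1.
  by apply: regular_epi_fill => //; rewrite me2 -compmA me1.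
apply: (@rank_regular_epi _ _ _ b).
by apply: (@regular_epi_cancel _ _ _ _ e1 b (rcat_regular C)); rewrite be1.
Qed.

(** The section of [a] and the retraction of [b] write each of [f] and [f'] as a composite through
    the other. *)
Lemma rank_image_iso X Y X' Y' (f : hom X Y) (f' : hom X' Y')
    (a : hom X X') (a' : hom X' X) (b : hom Y Y') (b' : hom Y' Y) :
  a \c a' = idm X' -> b' \c b = idm Y -> f' \c a = b \c f ->
  rank (image f') = rank (image f).
Proof.
move=> aa' b'b f'a; apply/le_anti/andP; split.
  have -> : f' = b \c (f \c a') by rewrite compmA -f'a -compmA aa' compm1.
  exact: le_trans (rank_image_compl _ _) (rank_image_compr _ _).
have -> : f = b' \c (f' \c a) by rewrite f'a compmA b'b comp1m.
exact: le_trans (rank_image_compl _ _) (rank_image_compr _ _).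
Qed.

End RankImage.

Lemma rank_image_color (Gamma : choiceType) (C : ranked_category)
    (Q : Gamma -> ranked_category) (c : coloring C Q) (g : Gamma)
    (X Y : C) (f : hom X Y) :
  rank (image (fmap (color c g) f)) = rank (color c g (image f)).
Proof.
apply: rank_imageE; have [e [m [re mm me]]] := imageP f.
exists (fmap (color c g) e), (fmap (color c g) m).
by rewrite -fmapM me; split=> //; [exact: color_regular_epi|exact: color_mono].
Qed.

Section RankImageColoring.
Variables (Gamma : choiceType) (C : ranked_category).
Variables (Q : Gamma -> ranked_category) (c : coloring C Q).

(** Both total ranks are sums over the finite set [B] of colors in which one of the two images has
    nonzero rank; a termwise inequality between equal sums is a termwise equality. *)
Lemma color_rank_image_le (X Y X' Y' : C) (f : hom X Y) (f' : hom X' Y') :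
  (forall g, rank (image (fmap (color c g) f)) <=
             rank (image (fmap (color c g) f'))) ->
  rank (image f) = rank (image f') ->
  forall g, rank (image (fmap (color c g) f)) =
            rank (image (fmap (color c g) f')).
Proof.
move=> lef eqf g.
pose B := [set g | rank (color c g (image f)) != 0] `|`
          [set g | rank (color c g (image f')) != 0].
have finB : finite_set B by rewrite finite_setU; split; exact: color_finite.
have rankB X0 : [set g | rank (color c g X0) != 0] `<=` B ->
    rank X0 = \sum_(h \in B) rank (color c h X0).
  move=> sB; rewrite (color_rank c); symmetry; apply: fsbig_widen => // h [_ /=].
  by apply: contra_notP => /eqP; exact: sB.
have [Bg|nBg] := pselect (B g); last first.
  rewrite !rank_image_color; move: nBg => /not_orP[].
  by rewrite /= => /negP/negPn/eqP-> /negP/negPn/eqP->.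
move: eqf; rewrite !rankB; [|by move=> h ?; right|by move=> h ?; left].
rewrite !fsbig_finite//= => eqf.
have /eqP : \sum_(h <- finmap.enum_fset (fset_set B)) (rank (color c h (image f')) -
    rank (color c h (image f))) = 0 by rewrite sumrB eqf subrr.
rewrite psumr_eq0 => [/allP/(_ g)|h _]; last first.
  by rewrite subr_ge0 -!rank_image_color.
rewrite in_fset_set// mem_set// => /(_ isT); rewrite subr_eq0 => /eqP.
by rewrite !rank_image_color.
Qed.

End RankImageColoring.

Lemma fmap_thin (T : Type) (le : rel T) (ler : reflexive le)
    (let_ : transitive le) (C : category) (F : functor (thin_cat ler let_) C)
    (x y z : T) (h : le x y) (h' : le y z) (h'' : le x z) :
  @fmap _ _ F y z h' \c @fmap _ _ F x y h = @fmap _ _ F x z h''.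
Proof. by rewrite -fmapM; congr fmap; exact: bool_irrelevance. Qed.

Lemma fmap_thin_id (T : Type) (le : rel T) (ler : reflexive le)
    (let_ : transitive le) (C : category) (F : functor (thin_cat ler let_) C)
    (x : T) (h : le x x) : @fmap _ _ F x x h = idm (F x).
Proof. by rewrite -fmap1; congr fmap; exact: bool_irrelevance. Qed.

Section ThinRank.
Variables (T : Type) (le : rel T).
Hypotheses (le_refl : reflexive le) (le_trans : transitive le).
Variables (C : ranked_category) (F : functor (thin_cat le_refl le_trans) C).

(* Only meaningful for [le x y]; [0] otherwise. *)
Definition thin_rank (x y : T) : int :=
  if pselect (le x y) is left h then
    rank (image (@fmap _ _ F x y h)) else 0.

Lemma thin_rankE x y (h : le x y) :
  thin_rank x y = rank (image (@fmap _ _ F x y h)).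
Proof.
by rewrite /thin_rank; case: pselect => // h'; rewrite (bool_irrelevance h' h).
Qed.

Lemma thin_rank_box a b c d : le a b -> le b c -> le c d ->
  thin_rank b d - thin_rank a d <= thin_rank b c - thin_rank a c.
Proof.
move=> ab bc cd; have ac := le_trans ab bc; have bd := le_trans bc cd.
have ad := le_trans ab bd.
rewrite (thin_rankE bd) (thin_rankE ad) (thin_rankE bc) (thin_rankE ac).
rewrite -(fmap_thin F ab bc ac) -(fmap_thin F bc cd bd) -(fmap_thin F ab bd ad).
by rewrite -(fmap_thin F bc cd bd); exact: rank_image_box.
Qed.

Lemma thin_rank_sub a b c d : le a b -> le b c -> le c d ->
  thin_rank a d <= thin_rank b c.
Proof.
move=> ab bc cd; have ac := le_trans ab bc; have ad := le_trans ac cd.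
rewrite (thin_rankE bc) (thin_rankE ad) -(fmap_thin F ac cd ad).
rewrite -(fmap_thin F ab bc ac).
exact: Order.POrderTheory.le_trans (rank_image_compl _ _) (rank_image_compr _ _).
Qed.

End ThinRank.

(** * Interpolation *)

Section DoubleSpan.
Variables (C : category) (A B X Y : C).
Variables (f1 : hom A X) (g1 : hom A Y) (f2 : hom B X) (g2 : hom B Y).

(* The indices [(false, _)] are the sources of the four arrows and the indices
   [(true, _)] are their targets. *)
Let dle : rel (bool * bool) := fun i j => (i == j) || (~~ i.1 && j.1).

Lemma dle_refl : reflexive dle.
Proof. by move=> i; rewrite /dle eqxx. Qed.

Lemma dle_trans : transitive dle.
Proof. by move=> [[] []] [[] []] [[] []]. Qed.

Let J := thin_cat dle_refl dle_trans.

Lemma finite_dspan : finite_category J.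
Proof.
split=> [|i j]; first exact: (@finite_finset (bool * bool)%type).
have [[h _]|no] := pselect ([set: @hom J i j] !=set0).
  by apply: (sub_finite_set _ (finite_set1 h)) => k _; exact: bool_irrelevance.
suff -> : [set: @hom J i j] = set0 by exact: finite_set0.
by rewrite -subset0 => h _; apply: no; exists h.
Qed.

Let dobj (i : bool * bool) : C :=
  match i with
  | (false, true) => A | (false, false) => B
  | (true, true) => X | (true, false) => Y
  end.

Let dmap (i j : bool * bool) : dle i j -> hom (dobj i) (dobj j) :=
  match i, j return dle i j -> hom (dobj i) (dobj j) with
  | (false, true), (false, true) => fun=> idm A
  | (false, false), (false, false) => fun=> idm B
  | (true, true), (true, true) => fun=> idm X
  | (true, false), (true, false) => fun=> idm Y
  | (false, true), (true, true) => fun=> f1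
  | (false, true), (true, false) => fun=> g1
  | (false, false), (true, true) => fun=> f2
  | (false, false), (true, false) => fun=> g2
  | _, _ => fun abs => False_rect _ (notF abs)
  end.

Let dmap1 (i : J) : dmap (@idm J i) = idm (dobj i).
Proof. by case: i => [[] []]. Qed.

Let dmapM (i j k : J) (b : hom j k) (a : hom i j) :
  dmap (b \c a) = dmap b \c dmap a.
Proof.
case: i a => [[] []]; case: j b => [[] []]; case: k => [[] []] //= b a;
  by rewrite ?comp1m ?compm1.
Qed.

Let dspan : functor J C := @Functor J C dobj dmap dmap1 dmapM.

Lemma double_span_colimit_ex : has_finite_colimits C ->
  exists (P : C) (a : hom X P) (b : hom Y P),
    [/\ a \c f1 = b \c g1, a \c f2 = b \c g2 &
     forall (Z : C) (u : hom X Z) (v : hom Y Z),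
       u \c f1 = v \c g1 -> u \c f2 = v \c g2 ->
       exists! w : hom P Z, w \c a = u /\ w \c b = v].
Proof.
move=> /(_ J dspan finite_dspan)[P [p [cone_p lim_p]]].
have pf1 := cone_p (false, true) (true, true) isT.
have pg1 := cone_p (false, true) (true, false) isT.
have pf2 := cone_p (false, false) (true, true) isT.
have pg2 := cone_p (false, false) (true, false) isT.
exists P, (p (true, true)), (p (true, false)).
split=> [||Z u v uv1 uv2]; [by rewrite pf1 pg1|by rewrite pf2 pg2|].
pose q (j : J) : hom (dspan j) Z :=
  match j as j return hom (dobj j) Z with
  | (false, true) => u \c f1 | (false, false) => u \c f2
  | (true, true) => u | (true, false) => v
  end.
have cone_q : is_cocone q.
  by move=> [[] []] [[] []] //= h; rewrite ?compm1.
have [w [wq uniq_w]] := lim_p Z q cone_q; exists w; split.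
  by split; [exact: (wq (true, true))|exact: (wq (true, false))].
move=> w' [wa wb]; apply: uniq_w => -[[] []] //=.
- by rewrite -pf1 compmA wa.
- by rewrite -pf2 compmA wa.
Qed.

End DoubleSpan.

Section Interpolation.
Variables (R : realType) (C : category) (F G : functor (real_cat R) C) (e : R).
Hypothesis colims : has_finite_colimits C.
Variables (phi : nat_trans F (fcomp G (shift e))).
Variables (psi : nat_trans G (fcomp F (shift e))).
Hypothesis psi_phi : forall (a : R) (h : a <= a + e + e),
  psi (a + e) \c phi a = @fmap _ _ F a (a + e + e) h.
Hypothesis phi_psi : forall (a : R) (h : a <= a + e + e),
  phi (a + e) \c psi a = @fmap _ _ G a (a + e + e) h.

Lemma fmap_real (D : category) (K : functor (real_cat R) D) (x y z : R)
    (h : x <= y) (h' : y <= z) (h'' : x <= z) :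
  @fmap _ _ K y z h' \c @fmap _ _ K x y h = @fmap _ _ K x z h''.
Proof. exact: fmap_thin. Qed.

Lemma fmap_real_id (D : category) (K : functor (real_cat R) D) (x : R)
    (h : x <= x) : @fmap _ _ K x x h = idm (K x).
Proof. exact: fmap_thin_id. Qed.

(* The condition that makes [u] and [v] a cocone on the restriction of the
   diagram made of [F], [G], [phi] and [psi] to the objects [F s] with [s <= x]
   and the objects [G s] with [s <= y]. *)
Definition compatible (x y : R) (Z : C) (u : hom (F x) Z) (v : hom (G y) Z) :=
  (forall (s : R) (h : s <= x) (h' : s + e <= y),
    u \c @fmap _ _ F s x h = v \c @fmap _ _ G (s + e) y h' \c phi s) /\
  (forall (s : R) (h : s <= y) (h' : s + e <= x),
    v \c @fmap _ _ G s y h = u \c @fmap _ _ F (s + e) x h' \c psi s).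

Definition universal_compatible (x y : R) (P : C) (a : hom (F x) P)
    (b : hom (G y) P) : Prop :=
  compatible a b /\
  forall (Z : C) (u : hom (F x) Z) (v : hom (G y) Z), compatible u v ->
    exists! w : hom P Z, w \c a = u /\ w \c b = v.

Lemma phi_fmap (s t : R) (h : s <= t) (h' : s + e <= t + e) :
  phi t \c @fmap _ _ F s t h = @fmap _ _ G (s + e) (t + e) h' \c phi s.
Proof. by rewrite -ncompP /=; congr (fmap _ _ \c _); exact: bool_irrelevance. Qed.

Lemma psi_fmap (s t : R) (h : s <= t) (h' : s + e <= t + e) :
  psi t \c @fmap _ _ G s t h = @fmap _ _ F (s + e) (t + e) h' \c psi s.
Proof. by rewrite -ncompP /=; congr (fmap _ _ \c _); exact: bool_irrelevance. Qed.

(** By naturality, each of the two families of compatibility conditions follows from its member with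
    the largest admissible index, [s] or [t] below. Only four objects remain, and their colimit is
    finite. *)
Lemma universal_compatible_ex (x y : R) :
  exists (P : C) (a : hom (F x) P) (b : hom (G y) P), universal_compatible a b.
Proof.
pose s := Num.min x (y - e); pose t := Num.min y (x - e).
have sx : s <= x by rewrite ge_min lexx.
have sy : s + e <= y by rewrite -lerBrDr ge_min lexx orbT.
have ty : t <= y by rewrite ge_min lexx.
have tx : t + e <= x by rewrite -lerBrDr ge_min lexx orbT.
have [P [a [b [ab1 ab2 univ]]]] :=
  double_span_colimit_ex (@fmap _ _ F s x sx)
    (@fmap _ _ G (s + e) y sy \c phi s)
    (@fmap _ _ F (t + e) x tx \c psi t) (@fmap _ _ G t y ty) colims.
have cocompat Z (u : hom (F x) Z) (v : hom (G y) Z) :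
    u \c @fmap _ _ F s x sx = v \c (@fmap _ _ G (s + e) y sy \c phi s) ->
    u \c (@fmap _ _ F (t + e) x tx \c psi t) = v \c @fmap _ _ G t y ty ->
    compatible u v.
  move=> uv1 uv2; split=> r h h'.
    have rs : r <= s by rewrite le_min h lerBrDr.
    rewrite -(fmap_real F rs sx) compmA uv1 -!compmA.
    have rs' : r + e <= s + e by rewrite lerD2r.
    by rewrite (phi_fmap rs rs') [X in v \c X]compmA (fmap_real G rs' sy h').
  have rt : r <= t by rewrite le_min h lerBrDr.
  rewrite -(fmap_real G rt ty) compmA -uv2 -!compmA.
  have rt' : r + e <= t + e by rewrite lerD2r.
  by rewrite (psi_fmap rt rt') [X in u \c X]compmA (fmap_real F rt' tx h').
exists P, a, b; split=> [|Z u v [uv1 uv2]]; first exact: cocompat.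
by apply: univ; rewrite ?(uv1 s sx sy) ?(uv2 t ty tx) !compmA.
Qed.

Definition interp_obj (d : R * R) : C :=
  sval (cid (universal_compatible_ex d.1 d.2)).
Definition interp_inl (d : R * R) : hom (F d.1) (interp_obj d) :=
  sval (cid (svalP (cid (universal_compatible_ex d.1 d.2)))).
Definition interp_inr (d : R * R) : hom (G d.2) (interp_obj d) :=
  sval (cid (svalP (cid (svalP (cid (universal_compatible_ex d.1 d.2)))))).

Lemma interpP (d : R * R) : universal_compatible (interp_inl d) (interp_inr d).
Proof.
exact: svalP (cid (svalP (cid (svalP (cid (universal_compatible_ex d.1 d.2)))))).
Qed.

Definition prod_le : rel (R * R) := fun d d' => (d.1 <= d'.1) && (d.2 <= d'.2).

Lemma prod_le_refl : reflexive prod_le.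
Proof. by move=> d; rewrite /prod_le !lexx. Qed.

Lemma prod_le_trans : transitive prod_le.
Proof.
move=> d d' d'' /andP[? ?] /andP[? ?].
by apply/andP; split; [apply: (@le_trans _ _ d.1)|apply: (@le_trans _ _ d.2)].
Qed.

Definition prod_real_cat : category := thin_cat prod_le_refl prod_le_trans.

Lemma compatible_comp (x x' y y' : R) (h : x <= x') (h' : y <= y') (Z : C)
    (u : hom (F x') Z) (v : hom (G y') Z) :
  compatible u v ->
  compatible (u \c @fmap _ _ F x x' h) (v \c @fmap _ _ G y y' h').
Proof.
move=> [uv1 uv2]; split=> s k k'.
  have sx' := le_trans k h; have sy' := le_trans k' h'.
  rewrite -!compmA (fmap_real F k h sx') [X in v \c X]compmA.
  by rewrite (fmap_real G k' h' sy') compmA; exact: uv1.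
have sy' := le_trans k h'; have sx' := le_trans k' h.
rewrite -!compmA (fmap_real G k h' sy') [X in u \c X]compmA.
by rewrite (fmap_real F k' h sx') compmA; exact: uv2.
Qed.

Lemma interp_map_ex (d d' : R * R) (h : d.1 <= d'.1) (h' : d.2 <= d'.2) :
  exists! w : hom (interp_obj d) (interp_obj d'),
    w \c interp_inl d = interp_inl d' \c @fmap _ _ F d.1 d'.1 h /\
    w \c interp_inr d = interp_inr d' \c @fmap _ _ G d.2 d'.2 h'.
Proof.
by apply: (interpP d).2; apply: compatible_comp; exact: (interpP d').1.
Qed.

Definition interp_map (d d' : R * R) (h : prod_le d d') :
    hom (interp_obj d) (interp_obj d') :=
  sval (cid (interp_map_ex (proj1 (andP h)) (proj2 (andP h)))).

Lemma interp_mapP (d d' : R * R) (h : prod_le d d')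
    (h1 : d.1 <= d'.1) (h2 : d.2 <= d'.2) :
  interp_map h \c interp_inl d = interp_inl d' \c @fmap _ _ F d.1 d'.1 h1 /\
  interp_map h \c interp_inr d = interp_inr d' \c @fmap _ _ G d.2 d'.2 h2.
Proof.
rewrite /interp_map; case: cid => w [[/= wl wr] _].
by rewrite wl wr; split; congr (_ \c fmap _ _); exact: bool_irrelevance.
Qed.

Lemma interp_map_uniq (d d' : R * R) (w w' : hom (interp_obj d) (interp_obj d')) :
  w \c interp_inl d = w' \c interp_inl d ->
  w \c interp_inr d = w' \c interp_inr d -> w = w'.
Proof.
move=> wl wr; have cw : compatible (w \c interp_inl d) (w \c interp_inr d).
  have [c1 c2] := (interpP d).1.
  split=> s h h'; first by rewrite -!compmA (c1 s h h') !compmA.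
  by rewrite -!compmA (c2 s h h') !compmA.
have [t [_ uniq_t]] := (interpP d).2 _ _ _ cw.
by rewrite -(uniq_t w)// -(uniq_t w').
Qed.

Lemma interp_map1 (d : prod_real_cat) :
  interp_map (@idm prod_real_cat d) = idm (interp_obj d).
Proof.
have [l r] := @interp_mapP d d (@idm prod_real_cat d) (lexx _) (lexx _).
apply: interp_map_uniq; first by rewrite l fmap_real_id comp1m compm1.
by rewrite r fmap_real_id comp1m compm1.
Qed.

Lemma interp_mapM (d1 d2 d3 : prod_real_cat) (k : hom d2 d3) (h : hom d1 d2) :
  interp_map (k \c h) = interp_map k \c interp_map h.
Proof.
have /andP[h1 h2] : prod_le d1 d2 := h; have /andP[k1 k2] : prod_le d2 d3 := k.
have [lh rh] := interp_mapP h h1 h2; have [lk rk] := interp_mapP k k1 k2.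
have [l r] := interp_mapP (k \c h) (le_trans h1 k1) (le_trans h2 k2).
apply: interp_map_uniq.
  by rewrite l -compmA lh compmA lk -compmA (fmap_real F h1 k1 (le_trans h1 k1)).
by rewrite r -compmA rh compmA rk -compmA (fmap_real G h2 k2 (le_trans h2 k2)).
Qed.

Definition interp : functor prod_real_cat C :=
  @Functor prod_real_cat C interp_obj interp_map interp_map1 interp_mapM.

(** Here every [G s] with [s <= d.2] maps by [psi] into [F (s + e)] with [s + e <= d.1], so [F d.1]
    is itself the colimit. The pair made of the identity and [v] is compatible because [psi_phi]
    turns the detour through [G] into a structure map of [F]. *)
Lemma interp_inl_iso (d : R * R) : 0 <= e -> d.2 <= d.1 - e ->
  exists b : hom (interp_obj d) (F d.1),
    b \c interp_inl d = idm _ /\ interp_inl d \c b = idm _.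
Proof.
move=> e0 yx; have yx' : d.2 + e <= d.1 by rewrite -lerBrDr.
pose v := @fmap _ _ F (d.2 + e) d.1 yx' \c psi d.2.
have cv : compatible (idm (F d.1)) v.
  split=> s h h'; rewrite /v comp1m; last first.
    have k : s + e <= d.2 + e by rewrite lerD2r.
    by rewrite -compmA (psi_fmap h k) compmA (fmap_real F k yx' h').
  have k : s + e + e <= d.2 + e by rewrite lerD2r.
  have se : s <= s + e + e by rewrite -addrA lerDl addr_ge0.
  rewrite -!compmA [in RHS](compmA (psi d.2)) (psi_fmap h' k) -compmA.
  by rewrite (psi_phi se) (fmap_real F se k (le_trans se k)) fmap_real.
have [b [[bl br] _]] := (interpP d).2 _ _ _ cv.
exists b; split=> //; apply: interp_map_uniq.
  by rewrite -compmA bl compm1 comp1m.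
rewrite -compmA br comp1m /v.
have [_ c2] := (interpP d).1.
by rewrite compmA -(c2 _ (lexx _) yx') fmap_real_id compm1.
Qed.

Lemma interp_inr_iso (d : R * R) : 0 <= e -> d.1 <= d.2 - e ->
  exists b : hom (interp_obj d) (G d.2),
    b \c interp_inr d = idm _ /\ interp_inr d \c b = idm _.
Proof.
move=> e0 yx; have yx' : d.1 + e <= d.2 by rewrite -lerBrDr.
pose v := @fmap _ _ G (d.1 + e) d.2 yx' \c phi d.1.
have cv : compatible v (idm (G d.2)).
  split=> s h h'; rewrite /v comp1m.
    have k : s + e <= d.1 + e by rewrite lerD2r.
    by rewrite -compmA (phi_fmap h k) compmA (fmap_real G k yx' h').
  have k : s + e + e <= d.1 + e by rewrite lerD2r.
  have se : s <= s + e + e by rewrite -addrA lerDl addr_ge0.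
  rewrite -!compmA [in RHS](compmA (phi d.1)) (phi_fmap h' k) -compmA.
  by rewrite (phi_psi se) (fmap_real G se k (le_trans se k)) fmap_real.
have [b [[bl br] _]] := (interpP d).2 _ _ _ cv.
exists b; split=> //; apply: interp_map_uniq.
  rewrite -compmA bl comp1m /v.
  have [c1 _] := (interpP d).1.
  by rewrite compmA -(c1 _ (lexx _) yx') fmap_real_id compm1.
by rewrite -compmA br compm1 comp1m.
Qed.

End Interpolation.

(** * Refinement of multiplicities *)

Section Cells.
Implicit Types (q : nat -> nat -> int) (c : nat * nat).

Definition box_ge0 q := forall i j k l : nat, (i <= j <= k)%N -> (k <= l)%N ->
  q j l - q i l <= q j k - q i k.

(* If [q i j] is the rank of the map from index [i] to index [j] of a sequence
   of objects, this is the multiplicity of the class of features that are born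
   between the indices [c.1] and [c.1.+1] and die between the indices [c.2] and
   [c.2.+1]. *)
Definition cell_mult q c : nat :=
  absz (q c.1.+1 c.2 - q c.1 c.2 - (q c.1.+1 c.2.+1 - q c.1 c.2.+1))%R.

Lemma cell_multE q c : box_ge0 q -> (c.1 < c.2)%N ->
  (cell_mult q c)%:Z =
  q c.1.+1 c.2 - q c.1 c.2 - (q c.1.+1 c.2.+1 - q c.1 c.2.+1).
Proof.
by move=> q0 c12; rewrite /cell_mult gez0_abs// subr_ge0; apply: q0; rewrite ?leqnSn.
Qed.

(* The cells of a sequence indexed by [2 i + s] refine into four cells. *)
Definition subcells (s : nat) c : seq (nat * nat) :=
  [seq (i, j) | i <- iota (c.1.*2 + s) 2, j <- iota (c.2.*2 + s) 2].

Lemma subcellsP s c d : reflect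
  (((c.1.*2 + s <= d.1) && (d.1 <= (c.1.*2 + s).+1)) /\
   ((c.2.*2 + s <= d.2) && (d.2 <= (c.2.*2 + s).+1)))%N
  (d \in subcells s c).
Proof.
case: c d => [i j] [a b]; apply: (iffP allpairsP) => [[[x y]]|[ha hb]].
  by rewrite !mem_iota !addn2 !ltnS => -[/= ? ? [-> ->]].
by exists (a, b); rewrite !mem_iota !addn2 !ltnS.
Qed.

Lemma subcells_uniq s c : uniq (subcells s c).
Proof.
apply: allpairs_uniq; [exact: iota_uniq|exact: iota_uniq|].
by move=> [? ?] [? ?] _ _ /= [-> ->].
Qed.

(** Second differences telescope. Since [c.1 < c.2], all four subcells lie strictly above the
    diagonal, where the absolute value in [cell_mult] changes nothing. *)
Lemma sum_subcells q s c : box_ge0 q -> (c.1 < c.2)%N ->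
  (cell_mult (fun i j => q (i.*2 + s)%N (j.*2 + s)%N) c =
   \sum_(d <- subcells s c) cell_mult q d)%N.
Proof.
move=> q0 c12; apply/eqP; rewrite -eqz_nat; apply/eqP.
have q0s : box_ge0 (fun i j => q (i.*2 + s)%N (j.*2 + s)%N).
  by move=> i j k l /andP[ij jk] kl; apply: q0; rewrite !leq_add2r !leq_double
    ?ij.
rewrite cell_multE// /subcells /= !big_cons big_nil addn0 !PoszD.
rewrite !cell_multE//=; try lia.
by rewrite !doubleS !addSn; ring.
Qed.

Definition is_copy q (x : nat * nat * nat) : bool := (x.2 < cell_mult q x.1)%N.

Definition copies q (l : seq (nat * nat)) : seq (nat * nat * nat) :=
  [seq (d, k) | d <- l, k <- iota 0 (cell_mult q d)].

Lemma mem_copies q l x : (x \in copies q l) = (x.1 \in l) && is_copy q x.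
Proof.
apply/allpairsPdep/andP => [[d [k [dl + ->]]]|[xl kx]].
  by rewrite mem_iota add0n.
by exists x.1, x.2; rewrite mem_iota add0n; case: x xl kx.
Qed.

Lemma copies_uniq q l : uniq l -> uniq (copies q l).
Proof.
move=> ul; apply: allpairs_uniq_dep => // [d _|]; first exact: iota_uniq.
by move=> [? ?] [? ?] _ _ /= [-> ->].
Qed.

Lemma size_copies q l : size (copies q l) = (\sum_(d <- l) cell_mult q d)%N.
Proof.
rewrite size_allpairs_dep sumnE big_map; apply: eq_bigr => d _.
by rewrite size_iota.
Qed.

(** One-sided, because passing from even to odd terms lowers each index by 0 or 1; the drift is
    centered later by shifting the grid of the second diagram. *)
Definition near_cell (t : nat) c c' : bool :=
  [&& c'.1 <= c.1, c.1 <= c'.1 + t, c'.2 <= c.2 & c.2 <= c'.2 + t]%N.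

(** A partial matching: copies of cells within [t] of the diagonal are left out, as moving by [t]
    could push them across it. *)
Definition cell_matching (t : nat) q q' : Prop :=
  exists f : nat * nat * nat -> nat * nat * nat,
    (forall x, is_copy q x -> (x.1.1 + t < x.1.2)%N ->
       is_copy q' (f x) /\ near_cell t x.1 (f x).1) /\
    (forall x y, is_copy q x -> (x.1.1 + t < x.1.2)%N ->
       is_copy q y -> (y.1.1 + t < y.1.2)%N -> f x = f y -> x = y).

Lemma cell_matching_refl q : cell_matching 0 q q.
Proof.
exists id; split=> // -[[i j] k] xq _; split=> //.
by rewrite /near_cell /= !addn0 !leqnn.
Qed.

Lemma cell_matching_trans t u q1 q2 q3 : cell_matching t q1 q2 ->
  cell_matching u q2 q3 -> cell_matching (t + u) q1 q3.
Proof.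
move=> [f [fP finj]] [g [gP ginj]].
have tu (x : nat * nat * nat) : (x.1.1 + (t + u) < x.1.2 -> x.1.1 + t < x.1.2)%N.
  by apply: leq_ltn_trans; rewrite addnA leq_addr.
have fu x : is_copy q1 x -> (x.1.1 + (t + u) < x.1.2)%N ->
    ((f x).1.1 + u < (f x).1.2)%N.
  move=> qx lx; have [_ /and4P[? _ _ ?]] := fP _ qx (tu _ lx).
  lia.
exists (g \o f); split=> [x qx lx|x y qx lx qy ly /= gfxy].
  have [q2x /and4P[a1 a2 a3 a4]] := fP _ qx (tu _ lx).
  have [q3x /and4P[b1 b2 b3 b4]] := gP _ q2x (fu _ qx lx); split=> //.
  by apply/and4P; split=> /=; lia.
apply: finj => //; try exact: tu.
apply: ginj => //; try exact: fu.
  by case: (fP _ qx (tu _ lx)).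
by case: (fP _ qy (tu _ ly)).
Qed.

(** The cell of the odd subsequence that has [c] among its subcells, if both indices are positive;
    at index 0 the truncated predecessor gives a meaningless value. *)
Definition odd_cell c : nat * nat := (c.1.-1./2, c.2.-1./2).

Lemma subcell_odd_cell c d : (c.1 + 1 < c.2)%N -> d \in subcells 0 c ->
  (0 < d.1)%N ->
  [/\ d \in subcells 1 (odd_cell d), near_cell 1 c (odd_cell d) &
      ((odd_cell d).1 < (odd_cell d).2)%N].
Proof.
case: c d => [i j] [a b] /= ij; move/subcellsP => /= -[].
rewrite !addn0 => /andP[a1 a2] /andP[b1 b2] a0.
have ha := odd_double_half a.-1; have hb := odd_double_half b.-1.
rewrite /odd_cell /=; move: (odd _) ha => oa ha; move: (odd _) hb => ob hb.
move: a.-1./2 ha b.-1./2 hb => x ha y hb.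
split; [apply/subcellsP => /=|apply/and4P; split => /=|rewrite /=];
  by case: oa ha => /= ha; case: ob hb => /= hb; lia.
Qed.

(* A copy of a cell of the even subsequence is a copy of one of its subcells,
   which is in turn a subcell of a cell of the odd subsequence. *)
Lemma cell_matching_interlace q : box_ge0 q -> (forall j, q 0 j = q 1 j) ->
  cell_matching 1 (fun i j => q i.*2 j.*2) (fun i j => q i.*2.+1 j.*2.+1).
Proof.
move=> q0 q01.
have sum0 c : (c.1 < c.2)%N -> (cell_mult (fun i j => q i.*2 j.*2) c =
    size (copies q (subcells 0 c)))%N.
  move=> c12; rewrite size_copies -sum_subcells//.
  by rewrite /cell_mult !addn0.
have sum1 c : (c.1 < c.2)%N -> (cell_mult (fun i j => q i.*2.+1 j.*2.+1) c =
    size (copies q (subcells 1 c)))%N.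
  move=> c12; rewrite size_copies -sum_subcells//.
  by rewrite /cell_mult !addn1.
pose x0 : nat * nat * nat := ((0, 0), 0)%N.
(* [f] reads the number of a copy as a position in the list of all copies of the subcells; [g] turns
   a copy of a subcell back into a position in the list of the odd cell around it. *)
pose f x := nth x0 (copies q (subcells 0 x.1)) x.2.
pose g (x : nat * nat * nat) :=
  (odd_cell x.1, index x (copies q (subcells 1 (odd_cell x.1)))).
have fP x : is_copy (fun i j => q i.*2 j.*2) x -> (x.1.1 < x.1.2)%N ->
    f x \in copies q (subcells 0 x.1).
  by rewrite /is_copy => + x12; rewrite sum0// => ?; apply: mem_nth.
have gP x : is_copy (fun i j => q i.*2 j.*2) x -> (x.1.1 + 1 < x.1.2)%N ->
    [/\ f x \in copies q (subcells 1 (odd_cell (f x).1)),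
        near_cell 1 x.1 (odd_cell (f x).1) &
        ((odd_cell (f x).1).1 < (odd_cell (f x).1).2)%N].
  move=> qx x12; have x12' : (x.1.1 < x.1.2)%N.
    by apply: leq_ltn_trans x12; rewrite leq_addr.
  have := fP _ qx x12'; rewrite !mem_copies => /andP[sfx qfx].
  (* A subcell with first index 0 lies in no odd cell, but it has multiplicity 0 because rows 0 and
     1 of [q] agree. *)
  have fx0 : (0 < (f x).1.1)%N.
    case: (posnP (f x).1.1) => // fx0.
    by move: qfx; rewrite /is_copy /cell_mult fx0 !q01 !subrr.
  by have [-> nx lx] := subcell_odd_cell x12 sfx fx0.
exists (g \o f); split=> [x qx lx|x y qx lx qy ly].
  have [fx nx lfx] := gP _ qx lx; split=> //.
  by rewrite /is_copy /= sum1// index_mem.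
have x12 : (x.1.1 < x.1.2)%N by apply: leq_ltn_trans lx; rewrite leq_addr.
have y12 : (y.1.1 < y.1.2)%N by apply: leq_ltn_trans ly; rewrite leq_addr.
have [fx _ _] := gP _ qx lx; have [fy _ _] := gP _ qy ly.
rewrite /g /= => -[e1 e2 e3].
have eup : odd_cell (f x).1 = odd_cell (f y).1 by rewrite /odd_cell e1 e2.
have fxy : f x = f y.
  have <- := nth_index x0 fx; rewrite e3 [in LHS]eup; exact: nth_index.
have := fP _ qx x12; have := fP _ qy y12; rewrite -fxy !mem_copies.
move=> /andP[/subcellsP + _] /andP[/subcellsP + _]; rewrite !addn0.
case: x y qx qy fxy {lx ly fx fy e1 e2 e3 eup x12 y12} (x12) (y12) =>
  [[i j] k] [[i' j'] k'] qx qy fxy x12 y12 /= Y X.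
(* Distinct cells of the even subsequence have disjoint sets of subcells. *)
have ii : i = i' by lia.
have jj : j = j' by lia.
rewrite {}ii {}jj in qx fxy *; congr (_, _).
apply/eqP; rewrite -(nth_uniq x0 _ _ (copies_uniq q (subcells_uniq 0 (i', j')))).
- exact/eqP.
- by rewrite -sum0//.
- by rewrite -sum0//.
Qed.

Lemma cell_matching_iter (N : nat) (q : nat -> nat -> nat -> int) :
  (forall t, (t < N)%N -> exists r, [/\ box_ge0 r, forall j, r 0%N j = r 1%N j,
     q t = (fun i j => r i.*2 j.*2) &
     q t.+1 = (fun i j => r i.*2.+1 j.*2.+1)]) ->
  cell_matching N (q 0%N) (q N).
Proof.
elim: N => [|N IHN] qr; first exact: cell_matching_refl.
rewrite -[X in cell_matching X]addn1; apply: (@cell_matching_trans _ _ _ (q N)).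
  by apply: IHN => t tN; apply: qr; rewrite ltnS ltnW.
have [r [r0 r01 -> ->]] := qr N (ltnSn N).
exact: cell_matching_interlace.
Qed.

End Cells.

(** * Persistent ranks *)

Lemma int_minP (A : set int) (lb : int) : A !=set0 -> lbound A lb ->
  A (int_min A) /\ lbound A (int_min A).
Proof.
move=> [a Aa] lbA; rewrite /int_min; case: xgetP => [m _ //|no].
pose P n := `[< A (lb + n%:Z) >].
have exP : exists n, P n.
  exists (absz (a - lb)%R); apply/asboolP; rewrite gez0_abs ?subr_ge0 ?lbA//.
  by rewrite addrC subrK.
case: (ex_minnP exP) => n /asboolP An nmin; case: (no (lb + n%:Z)).
split=> // k Ak; have lbk := lbA _ Ak.
have /nmin : P (absz (k - lb)%R).
  by apply/asboolP; rewrite gez0_abs ?subr_ge0// addrC subrK.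
by rewrite -lez_nat gez0_abs ?subr_ge0// lerBrDl.
Qed.

Lemma int_minE (A : set int) (m : int) : A m -> lbound A m -> int_min A = m.
Proof.
move=> Am mA; have [Aim imA] := int_minP (ex_intro _ _ Am) mA.
by apply/le_anti; rewrite imA// mA.
Qed.

Section Rank.
Variables (R : realType) (C : ranked_category) (F : functor (real_cat R) C).
Implicit Types (a b c d x y : R).

Lemma prankE x y (h : x <= y) : prank F x y = rank (image (@fmap _ _ F x y h)).
Proof. exact: thin_rankE. Qed.

Lemma prank_box a b c d : a <= b -> b <= c -> c <= d ->
  prank F b d - prank F a d <= prank F b c - prank F a c.
Proof. exact: thin_rank_box. Qed.

Lemma prank_sub a b c d : a <= b -> b <= c -> c <= d ->
  prank F a d <= prank F b c.
Proof. exact: thin_rank_sub. Qed.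

(** The value of [eprank] as soon as one of its arguments is infinite. *)
Definition min_rank : int :=
  int_min [set n | exists x y, x <= y /\ n = prank F x y].

Lemma min_rankP : (exists x y, x <= y /\ min_rank = prank F x y) /\
  forall x y, x <= y -> min_rank <= prank F x y.
Proof.
have [m mP] := rank_lower_bounded C.
have [||? minP] := @int_minP [set n | exists x y, x <= y /\ n = prank F x y] m.
- by exists (prank F 0 0), 0, 0.
- by move=> _ [x [y [xy ->]]]; rewrite (prankE xy).
by split=> // x y xy; apply: minP; exists x, y.
Qed.

(** If [a] or [d] is infinite, the terms containing it equal the global minimum, and the box
    inequality reduces to monotonicity of [prank] or to minimality. *)
Lemma eprank_box (a b c d : \bar R) : (a <= b)%E -> (b <= c)%E -> (c <= d)%E ->
  eprank F b d - eprank F a d <= eprank F b c - eprank F a c.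
Proof.
have [_ minP] := min_rankP.
case: a => [a||]; case: b => [b||]; case: c => [c||]; case: d => [d||] //=;
  rewrite ?lee_fin ?leye_eq ?leeNy_eq// => ab bc cd; rewrite -?/min_rank ?subrr//.
- exact: prank_box.
- by rewrite subr_ge0 (prank_sub ab bc (lexx _)).
- by rewrite lerD2r; apply: prank_sub.
- by rewrite subr_ge0; apply: minP.
Qed.

Definition const_between x y : Prop :=
  prank F x x = prank F x y /\ prank F x y = prank F y y.

Lemma const_between_trans x y z : x <= y -> y <= z ->
  const_between x y -> const_between y z -> const_between x z.
Proof.
move=> xy yz [xy1 xy2] [yz1 yz2].
have := prank_box xy (lexx y) yz; rewrite /const_between.
have := prank_sub (lexx x) xy yz; lia.
Qed.

(** By the box inequality the rank lost on precomposing with the map from [x] to [y] is at most the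
    rank lost at [y] itself, which is 0. *)
Lemma const_between_prankl x y z : x <= y -> y <= z -> const_between x y ->
  prank F x z = prank F y z.
Proof.
move=> xy yz [xy1 xy2]; have := prank_box xy (lexx y) yz.
have := prank_sub xy yz (lexx z); lia.
Qed.

Lemma const_between_prankr x y z : z <= x -> x <= y -> const_between x y ->
  prank F z x = prank F z y.
Proof.
move=> zx xy [xy1 xy2]; have := prank_box zx (lexx x) xy.
have := prank_sub (lexx z) zx xy; lia.
Qed.

Lemma const_between_eprankl x y (z : \bar R) : x <= y -> (y%:E <= z)%E ->
  const_between x y -> eprank F x%:E z = eprank F y%:E z.
Proof. by case: z => [z||]//= xy yz; exact: const_between_prankl. Qed.

Lemma const_between_eprankr x y (z : \bar R) : (z <= x%:E)%E -> x <= y ->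
  const_between x y -> eprank F z x%:E = eprank F z y%:E.
Proof. by case: z => [z||]//= zx xy; exact: const_between_prankr. Qed.

Lemma regular_value_nbhs x : regular_value F x ->
  exists2 r, 0 < r & forall y z, x - r < y -> y <= z -> z < x + r ->
    const_between y z.
Proof.
move=> [I [/nbhs_ballP[r /= r0 rI] _ cI]]; exists r => // y z ry yz zr.
by apply: cI => //; apply: rI; rewrite /ball/= ltr_distlC; apply/andP; split;
  rewrite // ?(lt_le_trans ry)// (le_lt_trans yz).
Qed.

(** Compactness in the form of a supremum argument: if constancy from [a] reaches points arbitrarily
    close to [s], regularity at [s] carries it past [s], unless [b] comes first. *)
Lemma regular_const_between a b : a <= b ->
  (forall x, a <= x <= b -> regular_value F x) -> const_between a b.
Proof.
move=> ab reg; pose T := [set t | a <= t <= b /\ const_between a t].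
have Ta : T a by rewrite /T /= lexx ab; split=> //; split.
have supT : has_sup T by split; [exists a|exists b => t [/andP[]]].
pose s := sup T; have aS : a <= s by apply: sup_upper_bound.
have sb : s <= b by apply: ge_sup; [exists a|move=> t [/andP[]]].
have [r r0 rP] := regular_value_nbhs (reg s ltac:(by rewrite aS)).
have [t [/andP[a_t tb] ct] st] := sup_adherent r0 supT; rewrite -/s in st.
pose s' := Num.min b (s + r / 2).
have r20 : 0 < r / 2 by rewrite divr_gt0.
have ts : t <= s by apply: sup_upper_bound => //; split=> //; rewrite a_t.
have ts' : t <= s' by rewrite le_min tb (le_trans ts)// lerDl ltW.
have Ts' : T s'.
  split; first by rewrite (le_trans a_t ts') ge_min lexx.
  apply: const_between_trans ct _ => //; apply: rP => //.
  rewrite gt_min; apply/orP; right; rewrite ltrD2l.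
  by rewrite ltr_pdivrMr// mulr_natr mulr2n ltrDl.
have := sup_upper_bound supT Ts'; rewrite -/s ge_min => /orP[bs|].
  have -> : b = s' by rewrite /s' min_l// (le_trans bs)// lerDl ltW.
  exact: Ts'.2.
by rewrite gerDl leNgt r20.
Qed.

(* The difference of ranks whose minimum over neighborhoods defines
   [multiplicity]. *)
Definition ebox (a b c d : \bar R) : int :=
  eprank F b c - eprank F a c - eprank F b d + eprank F a d.

(** Moving the four endpoints outward one at a time adds a nonnegative box each time. *)
Lemma ebox_le (a b c d a' b' c' d' : \bar R) :
  (a' <= a)%E -> (a <= b)%E -> (b <= b')%E -> (b' <= c')%E ->
  (c' <= c)%E -> (c <= d)%E -> (d <= d')%E ->
  ebox a b c d <= ebox a' b' c' d'.
Proof.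
move=> a'a ab bb' bc' c'c cd dd'; rewrite /ebox.
have bc := le_trans bc' c'c; have ab' := le_trans ab bb'.
have a'b' := le_trans a'a ab'; have cd' := le_trans cd dd'.
have := eprank_box bb' bc cd; have := eprank_box a'a (le_trans ab' bc) cd.
have := eprank_box a'b' bc' c'c; have := eprank_box a'b' (le_trans bc cd) dd'.
lia.
Qed.

Lemma ebox_ge0 (a b c d : \bar R) : (a <= b)%E -> (b <= c)%E -> (c <= d)%E ->
  0 <= ebox a b c d.
Proof. by move=> ab bc cd; have := eprank_box ab bc cd; rewrite /ebox; lia. Qed.

End Rank.

(** * Multiplicities at isolated critical values *)

Section ExtendedIntervals.
Variable R : realType.
Implicit Types (a b u v : \bar R) (x y : R).

Lemma ereal_sup_maximum (I : set (\bar R)) b : I b -> ubound I b ->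
  ereal_sup I = b.
Proof.
move=> Ib bI; apply/le_anti/andP; split; first exact: ge_ereal_sup.
exact: ereal_sup_ubound.
Qed.

Lemma ereal_inf_minimum (I : set (\bar R)) a : I a -> lbound I a ->
  ereal_inf I = a.
Proof.
move=> Ia aI; apply/le_anti/andP; split; last exact: le_ereal_inf_tmp.
exact: ereal_inf_lbound.
Qed.

(** If [u] were missing, the points of [I] below [u] would form a proper nonempty part that is both
    open and closed in [I]. *)
Lemma connected_ereal_interval (I : set (\bar R)) a b u :
  connected I -> I a -> I b -> (a <= u)%E -> (u <= b)%E -> I u.
Proof.
move=> cI Ia Ib; rewrite le_eqVlt => /predU1P[<-//|au].
rewrite le_eqVlt => /predU1P[->//|ub]; apply: contrapT => nIu.
suff /seteqP[_ /(_ b Ib)[_ /=]] : I `&` [set z | (z < u)%E] = I.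
  by rewrite ltNge (ltW ub).
apply: cI; first by exists a.
  by exists [set z | (z < u)%E] => //; exact: open_ereal_lt_ereal.
exists [set z | (z <= u)%E]; first exact: closed_ereal_ge_ereal.
apply/seteqP; split=> z [Iz /= zu]; split=> //=; first exact: ltW.
by rewrite lt_neqAle zu andbT; apply/eqP => zu'; apply: nIu; rewrite -zu'.
Qed.

Lemma connected_EFin_image (A : set R) : is_interval A ->
  connected (EFin @` A).
Proof.
move=> /connected_intervalP cA; apply: connected_continuous_connected cA _.
by apply: continuous_subspaceT => x B; rewrite /nbhs/= /ereal_nbhs.
Qed.

(** For [a < b] the segment is the closure of the image of a real interval, and closures of
    connected sets are connected. *)
Lemma connected_ereal_segment a b : connected [set z | (a <= z <= b)%E].
Proof.
have [ab|ba|<-] := ltgtP a b; last 2 first.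
- rewrite (_ : mkset _ = set0); first exact: connected0.
  by rewrite -subset0 => z /= /andP[az /(le_trans az)]; rewrite leNgt ba.
- rewrite (_ : mkset _ = [set a]); first exact: connected1.
  apply/seteqP; split=> z /=; first by rewrite -eq_le => /eqP ->.
  by move=> ->; rewrite lexx.
pose A := [set x : R | (a <= x%:E <= b)%E].
have [m [am mb]] : exists m, (a < m%:E)%E /\ (m%:E < b)%E.
  case: a b ab {A} => [a||] [b||]//= ab.
  - exists ((a + b) / 2); rewrite !lte_fin in ab *; lra.
  - by exists (a + 1); rewrite lte_fin ltry; split=> //; lra.
  - by exists (b - 1); rewrite lte_fin ltNyr; split=> //; lra.
  - by exists 0; rewrite ltry ltNyr.
suff -> : [set z | (a <= z <= b)%E] = closure (EFin @` A).
  apply/connected_closure/connected_EFin_image => x y /=.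
  rewrite /A /= => /andP[ax _] /andP[_ yb] z /andP[xz zy].
  by rewrite (le_trans ax) ?lee_fin// (le_trans _ yb) ?lee_fin.
apply/seteqP; split=> [z /andP[]|]; last first.
  have -> : [set z | (a <= z <= b)%E] = [set z | (a <= z)%E] `&` [set z | (z <= b)%E].
    by apply/seteqP; split=> z /= => [/andP//|[-> ->]].
  rewrite [X in _ `<=` X](closure_id _).1; last first.
    by apply: closedI; [exact: closed_ereal_le_ereal|exact: closed_ereal_ge_ereal].
  by apply: closureS => _ [x /andP[ax xb] <-]; split.
case: z => [x||] az zb.
- by apply: subset_closure; exists x => //; rewrite /A /= az.
- move=> B [M [_ MB]]; exists (Num.max (M + 1) m)%:E; split.
    exists (Num.max (M + 1) m) => //; rewrite /A /= (le_trans (ltW am));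
      rewrite ?lee_fin ?le_max ?lexx ?orbT//.
    by rewrite (le_trans _ zb)// leey.
  by apply: MB; rewrite lte_fin lt_max ltrDl ltr01.
- move=> B [M [_ MB]]; exists (Num.min (M - 1) m)%:E; split.
    exists (Num.min (M - 1) m) => //; rewrite /A /= (le_trans az) ?leNye//=.
    by rewrite (le_trans _ (ltW mb))// lee_fin ge_min lexx orbT.
  by apply: MB; rewrite lte_fin gt_min gtrDl ltrN10.
Qed.

Lemma nbhs_ereal_segment a x b : (a < x%:E)%E -> (x%:E < b)%E ->
  nbhs x%:E [set z | (a <= z <= b)%E].
Proof.
move=> ax xb; apply: filterS (filterI (open_ereal_gt' ax) (open_ereal_lt' xb)).
by move=> z [/ltW az /ltW zb]; apply/andP.
Qed.

End ExtendedIntervals.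

Section Multiplicity.
Variables (R : realType) (C : ranked_category) (F : functor (real_cat R) C).
Implicit Types (a b c d u v : \bar R) (x y : R).

(** Reduces arbitrary connected neighborhoods to closed segments: the box only sees the infimum and
    supremum. The lower bound allows [b = c], since disjoint neighborhoods may have a common
    endpoint in their closures. *)
Lemma multiplicityE u v (n : int) : (u < v)%E ->
  (exists a b c d, [/\ nbhs u [set z | (a <= z <= b)%E],
     nbhs v [set z | (c <= z <= d)%E], (b < c)%E & n = ebox F a b c d]) ->
  (forall a b c d, nbhs u [set z | (a <= z <= b)%E] ->
     nbhs v [set z | (c <= z <= d)%E] -> (b <= c)%E -> n <= ebox F a b c d) ->
  multiplicity F u v = n.
Proof.
move=> uv [a [b [c [d [abu cdv bc nE]]]]] lbn; apply: int_minE.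
  have /andP[au ub] := nbhs_singleton abu.
  have /andP[cv vd] := nbhs_singleton cdv.
  exists [set z | (a <= z <= b)%E], [set z | (c <= z <= d)%E]; split.
  - by split=> //; exact: connected_ereal_segment.
  - by split=> //; exact: connected_ereal_segment.
  - rewrite -subset0 => z [/= /andP[_ zb] /andP[cz _]].
    by move: (le_trans cz zb); rewrite leNgt bc.
  have -> : ereal_sup [set z | (a <= z <= b)%E] = b.
    by apply: ereal_sup_maximum => [|z /andP[]//] /=; rewrite lexx (le_trans au).
  have -> : ereal_inf [set z | (a <= z <= b)%E] = a.
    by apply: ereal_inf_minimum => [|z /andP[]//] /=; rewrite lexx (le_trans au).
  have -> : ereal_sup [set z | (c <= z <= d)%E] = d.
    by apply: ereal_sup_maximum => [|z /andP[]//] /=; rewrite lexx (le_trans cv).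
  have -> : ereal_inf [set z | (c <= z <= d)%E] = c.
    by apply: ereal_inf_minimum => [|z /andP[]//] /=; rewrite lexx (le_trans cv).
  exact: nE.
move=> _ [Iu [Iv [[nu cu] [nv cv] IuIv ->]]].
apply: lbn.
- apply: filterS nu => z Iuz /=.
  by rewrite ereal_inf_lbound// ereal_sup_ubound.
- apply: filterS nv => z Ivz /=.
  by rewrite ereal_inf_lbound// ereal_sup_ubound.
have disj z : Iu z -> Iv z -> False.
  by move=> Iuz Ivz; have : (Iu `&` Iv) z by []; rewrite IuIv.
have Iuu := nbhs_singleton nu; have Ivv := nbhs_singleton nv.
(* Disjoint intervals around [u < v] are ordered: if [y < x], then [y] or [u] would lie in both. *)
apply: ge_ereal_sup => x Iux; apply: le_ereal_inf_tmp => y Ivy.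
rewrite leNgt; apply/negP => yx.
have [uy|yu] := leP u y.
  by apply: (disj y) => //; exact: (connected_ereal_interval cu Iuu Iux uy (ltW yx)).
apply: (disj u) => //.
exact: (connected_ereal_interval cv Ivy Ivv (ltW yu) (ltW uv)).
Qed.

(* The interval from [a] to [b] is a neighborhood of [u] in which no real number
   other than [u] is critical. *)
Definition isolates a u b : Prop :=
  match a, u, b with
  | a%:E, u%:E, b%:E => (a < u < b)%R /\
      forall x, (a <= x <= b)%R -> x != u -> regular_value F x
  | -oo, -oo, b%:E => forall x, (x <= b)%R -> regular_value F x
  | a%:E, +oo, +oo => forall x, (a <= x)%R -> regular_value F x
  | _, _, _ => False
  end%E.

Lemma isolates_bounds a u b : isolates a u b -> (a <= u <= b)%E.
Proof.
case: a => [a||]; case: u => [u||]; case: b => [b||] //=.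
- by move=> [/andP[? ?] _]; rewrite !lee_fin !ltW.
- by rewrite !leey.
- by rewrite !leNye.
Qed.

(** The endpoints can be moved toward [u] into any neighborhood without changing ranks, because only
    regular values are crossed. *)
Lemma isolates_shrink a u b (I : set (\bar R)) : isolates a u b -> nbhs u I ->
  exists a' b', [/\ isolates a' u b', nbhs u [set z | (a' <= z <= b')%E],
    I a' /\ I b', (a <= a')%E /\ (b' <= b)%E &
    forall z, ((b <= z)%E -> eprank F a z = eprank F a' z /\
                             eprank F b z = eprank F b' z) /\
              ((z <= a)%E -> eprank F z a = eprank F z a' /\
                             eprank F z b = eprank F z b')].
Proof.
case: a => [a||]; case: u => [u||]; case: b => [b||] //=.
- move=> [/andP[au ub] reg] uI.
  have /nbhs_ballP[r /= r0 rI] : nbhs u (fun x : R => I x%:E) by exact: uI.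
  have r2 : 0 < r / 2 by rewrite divr_gt0.
  pose a' := Num.max a (u - r / 2); pose b' := Num.min b (u + r / 2).
  have a'u : a' < u by rewrite gt_max au gtrDl oppr_lt0.
  have ub' : u < b' by rewrite lt_min ub ltrDl.
  have aa' : a <= a' by rewrite le_max lexx.
  have b'b : b' <= b by rewrite ge_min lexx.
  have raa' : const_between F a a'.
    apply: regular_const_between => // x /andP[ax xa']; apply: reg.
      by rewrite ax (le_trans xa')// ltW// (lt_trans a'u).
    by rewrite lt_eqF// (le_lt_trans xa').
  have rb'b : const_between F b' b.
    apply: regular_const_between => // x /andP[b'x xb]; apply: reg.
      by rewrite xb andbT (le_trans _ b'x)// ltW// (lt_trans au).
    by rewrite gt_eqF// (lt_le_trans ub').
  have a'b : a' <= b by rewrite ltW// (lt_trans a'u).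
  have ab' : a <= b' by rewrite ltW// (lt_trans au).
  exists a'%:E, b'%:E; split.
  - rewrite /= a'u ub'; split=> // x /andP[a'x xb'].
    by apply: reg; rewrite (le_trans aa')//= (le_trans xb').
  - by apply: nbhs_ereal_segment; rewrite lte_fin.
  - split; apply: (rI _); rewrite /ball/= ltr_distlC.
      by rewrite lt_max (lt_trans a'u) ?ltrDl// andbT; apply/orP; right; lra.
    by rewrite gt_min (lt_trans _ ub') ?gtrDl ?oppr_lt0//=; apply/orP; right; lra.
  - by rewrite !lee_fin.
  move=> z; split=> [bz|za].
    split; first by apply: const_between_eprankl => //; rewrite (le_trans _ bz)// lee_fin.
    by symmetry; apply: const_between_eprankl.
  split; first exact: const_between_eprankr.
  by symmetry; apply: const_between_eprankr => //; rewrite (le_trans za)// lee_fin.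
- move=> reg [M [_ MI]]; pose a' := Num.max a (M + 1).
  have aa' : a <= a' by rewrite le_max lexx.
  have caa' : const_between F a a'.
    by apply: regular_const_between => // x /andP[ax _]; exact: reg.
  exists a'%:E, +oo%E; split=> //.
  - by move=> x a'x; apply: reg; exact: le_trans a'x.
  - exists a'; split; first exact: num_real.
    by move=> z a'z /=; rewrite (ltW a'z) leey.
  - by split; apply: MI; rewrite ?ltry// lte_fin lt_max ltrDl ltr01 orbT.
  move=> z; split=> [|za]; last by split=> //; exact: const_between_eprankr.
  by rewrite leye_eq => /eqP ->.
- move=> reg [M [_ MI]]; pose b' := Num.min b (M - 1).
  have b'b : b' <= b by rewrite ge_min lexx.
  have cb'b : const_between F b' b.
    by apply: regular_const_between => // x /andP[_ xb]; exact: reg.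
  exists -oo%E, b'%:E; split=> //.
  - by move=> x xb'; apply: reg; exact: le_trans b'b.
  - exists b'; split; first exact: num_real.
    by move=> z zb' /=; rewrite (ltW zb') leNye.
  - by split; apply: MI; rewrite ?ltNyr// lte_fin gt_min gtrDl ltrN10 orbT.
  move=> z; split=> [bz|].
    by split=> //; symmetry; exact: const_between_eprankl.
  by rewrite leeNy_eq => /eqP ->.
Qed.

(** The box over isolating intervals does not change when they shrink, and every competing pair of
    neighborhoods contains a shrunk pair, whose box is no larger. So the minimum is attained. *)
Lemma multiplicity_isolates a b c d u v :
  isolates a u b -> isolates c v d -> (u < v)%E -> (b <= c)%E ->
  multiplicity F u v = ebox F a b c d.
Proof.
move=> iu iv uv bc.
have key I J : nbhs u I -> nbhs v J -> exists a' b' c' d',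
    [/\ nbhs u [set z | (a' <= z <= b')%E], nbhs v [set z | (c' <= z <= d')%E],
        I a' /\ I b', J c' /\ J d' & ebox F a b c d = ebox F a' b' c' d'].
  move=> uI vJ.
  have [a' [b' [iu' nu' Iab [aa' b'b] Eab]]] := isolates_shrink iu uI.
  have [c' [d' [iv' nv' Jcd [cc' d'd] Ecd]]] := isolates_shrink iv vJ.
  exists a', b', c', d'; split=> //; rewrite /ebox.
  have /andP[cv vd] := isolates_bounds iv.
  have bd : (b <= d)%E by rewrite (le_trans bc)// (le_trans cv).
  have [[-> ->] [-> ->]] := ((Eab c).1 bc, (Eab d).1 bd).
  have /andP[a'u ub'] := isolates_bounds iu'.
  have b'c : (b' <= c)%E by exact: le_trans bc.
  have a'c : (a' <= c)%E by rewrite (le_trans _ b'c)// (le_trans a'u).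
  by have [[-> ->] [-> ->]] := ((Ecd a').2 a'c, (Ecd b').2 b'c).
apply: multiplicityE => //.
  have ub : (u < b)%E.
    case: a u b iu uv {bc key} => [a||] [u||] [b||] //=.
    - by move=> [/andP[]].
    - by rewrite ltNge leey.
    - by move=> _ _; exact: ltNyr.
  have cv : (c < v)%E.
    case: c v d iv uv {bc key} => [c||] [v||] [d||] //=.
    - by move=> [/andP[]].
    - by move=> _ _; exact: ltry.
    - by rewrite ltNge leNye.
  (* The intervals may touch at [b = c]; shrinking them strictly inside separates them. *)
  have [|a' [b' [c' [d' [nu' nv' [_ b'b] [cc' _] ->]]]]] :=
    key [set z | (z < b)%E] [set z | (c < z)%E] (open_ereal_lt' ub).
    exact: open_ereal_gt'.
  exists a', b', c', d'; split=> //.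
  by rewrite (lt_le_trans b'b)// (le_trans bc)// ltW.
move=> a0 b0 c0 d0 nu nv b0c0.
have [a' [b' [c' [d' [nu' nv' [/andP[? _] /andP[_ ?]] [/andP[? _] /andP[_ ?]] ->]]]]] :=
  key _ _ nu nv.
have /andP[? ?] := nbhs_singleton nu'; have /andP[? ?] := nbhs_singleton nv'.
by apply: ebox_le => //; [exact: (@le_trans _ _ u)|exact: (@le_trans _ _ v)].
Qed.

Lemma ebox_const_betweenl x y c d : x <= y -> (y%:E <= c)%E -> (c <= d)%E ->
  const_between F x y -> ebox F x%:E y%:E c d = 0.
Proof.
move=> xy yc cd cxy; rewrite /ebox.
rewrite (const_between_eprankl xy yc cxy).
rewrite (const_between_eprankl xy (le_trans yc cd) cxy); lia.
Qed.

Lemma ebox_const_betweenr x y a b : x <= y -> (b <= x%:E)%E -> (a <= b)%E ->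
  const_between F x y -> ebox F a b x%:E y%:E = 0.
Proof.
move=> xy bx ab cxy; rewrite /ebox.
rewrite (const_between_eprankr bx xy cxy).
rewrite (const_between_eprankr (le_trans ab bx) xy cxy); lia.
Qed.

(** A neighborhood of [x] on which [F] is constant, ending at [y] before [v], gives a box equal to
    0, the least possible value. *)
Lemma multiplicity_regularl x v : regular_value F x -> (x%:E < v)%E ->
  multiplicity F x%:E v = 0.
Proof.
move=> /regular_value_nbhs[r r0 rP] xv; apply: multiplicityE => //.
  have [y [xy yv yr]] : exists y, [/\ x < y, (y%:E < v)%E & y < x + r].
    case: v xv => [v||]// xv; last first.
      by exists (x + r / 2); rewrite ltry; split=> //; lra.
    exists (Num.min ((x + v) / 2) (x + r / 2)); rewrite lte_fin in xv.
    by rewrite lt_min lte_fin !gt_min; split; [lra|lra|]; apply/orP; right; lra.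
  have [m [ym mv]] : exists m, y < m /\ (m%:E < v)%E.
    case: v yv {xv} => [v||]// yv; last by exists (y + 1); rewrite ltry; split=> //; lra.
    by rewrite lte_fin in yv; exists ((y + v) / 2); rewrite lte_fin; lra.
  exists (x - r / 2)%:E, y%:E, m%:E, +oo%E; split.
  - by apply: nbhs_ereal_segment; rewrite lte_fin; lra.
  - case: v mv {xv yv} => [v||]// mv; first exact: nbhs_ereal_segment (ltry _).
    by exists m; split=> [|z mz /=]; rewrite ?num_real// (ltW mz) leey.
  - by rewrite lte_fin.
  rewrite ebox_const_betweenl ?leey ?lee_fin//; [lra|exact: ltW|].
  by apply: rP => //; lra.
move=> a b c d /nbhs_singleton/andP[ax xb] /nbhs_singleton/andP[cv vd] bc.
by apply: ebox_ge0 => //; [exact: le_trans xb|exact: le_trans vd].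
Qed.

Lemma multiplicity_regularr u x : regular_value F x -> (u < x%:E)%E ->
  multiplicity F u x%:E = 0.
Proof.
move=> /regular_value_nbhs[r r0 rP] ux; apply: multiplicityE => //.
  have [y [xy yv yr]] : exists y, [/\ y < x, (u < y%:E)%E & x - r < y].
    case: u ux => [u||]// ux; last first.
      by exists (x - r / 2); rewrite ltNyr; split=> //; lra.
    exists (Num.max ((x + u) / 2) (x - r / 2)); rewrite lte_fin in ux.
    by rewrite gt_max lte_fin !lt_max; split; [lra|lra|]; apply/orP; right; lra.
  have [m [ym mv]] : exists m, m < y /\ (u < m%:E)%E.
    case: u yv {ux} => [u||]// yv; last by exists (y - 1); rewrite ltNyr; split=> //; lra.
    by rewrite lte_fin in yv; exists ((y + u) / 2); rewrite lte_fin; lra.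
  exists -oo%E, m%:E, y%:E, (x + r / 2)%:E; split.
  - case: u mv {ux yv} => [u||]// mv; first exact: nbhs_ereal_segment (ltNyr _) _.
    by exists m; split=> [|z mz /=]; rewrite ?num_real// (ltW mz) leNye.
  - by apply: nbhs_ereal_segment; rewrite lte_fin; lra.
  - by rewrite lte_fin.
  rewrite ebox_const_betweenr ?leNye ?lee_fin//; [lra|exact: ltW|].
  by apply: rP => //; lra.
move=> a b c d /nbhs_singleton/andP[ax xb] /nbhs_singleton/andP[cv vd] bc.
by apply: ebox_ge0 => //; [exact: le_trans xb|exact: le_trans vd].
Qed.

(** By the convention for infinite arguments the box is [prank F x y - min_rank F]. A pair attaining
    the minimum can be widened to contain [x] and [y], and beyond these the rank is constant, so the
    difference vanishes. *)
Lemma multiplicity_infinite x y : x <= y ->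
  (forall z, z <= x -> regular_value F z) ->
  (forall z, y <= z -> regular_value F z) -> multiplicity F -oo%E +oo%E = 0.
Proof.
move=> xy regx regy.
rewrite (@multiplicity_isolates -oo%E x%:E y%:E +oo%E)//.
rewrite /ebox /= -/(min_rank F).
suff -> : min_rank F = prank F x y by lia.
have [[a [b [ab minE]]] minP] := min_rankP F; apply/le_anti.
rewrite minP//= minE; pose a' := Num.min a x; pose b' := Num.max b y.
have a'a : a' <= a by rewrite ge_min lexx.
have a'x : a' <= x by rewrite ge_min lexx orbT.
have bb' : b <= b' by rewrite le_max lexx.
have yb' : y <= b' by rewrite le_max lexx orbT.
have ca : const_between F a' x.
  by apply: regular_const_between => // z /andP[_]; exact: regx.
have cb : const_between F y b'.
  by apply: regular_const_between => // z /andP[+ _]; exact: regy.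
rewrite (const_between_prankr xy yb' cb).
by rewrite -(const_between_prankl a'x (le_trans xy yb') ca) prank_sub.
Qed.

End Multiplicity.

(** * Multiplicities on a grid *)

(* The ranks of a sequence of objects restricted to the indices from [l] to [n],
   the indices on either side standing for an object through which every map has
   rank [m]. *)
Definition window (l n : nat) (m : int) (p : nat -> nat -> int) (i j : nat) : int :=
  if [&& l <= i, i <= j & j <= n]%N then p i j else m.

(** As for [eprank_box], with the lower bound [m] in the role of the minimal rank. *)
Lemma window_box_ge0 (s n : nat) (m : int) (p : nat -> nat -> int) :
  (forall i j, (i <= j)%N -> m <= p i j) ->
  (forall i j k l, (i <= j <= k)%N -> (k <= l)%N -> p i l <= p j k) ->
  box_ge0 p -> box_ge0 (window s n m p).
Proof.
move=> mp psub pbox i j k l /andP[ij jk] kl; rewrite /window.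
have h1 := pbox i j k l ltac:(by rewrite ij jk) kl.
have h2 := psub j j k l ltac:(by rewrite leqnn jk) kl.
have h3 := psub i j k k ltac:(by rewrite ij jk) (leqnn k).
have h4 := mp j k jk.
rewrite jk (leq_trans ij jk) (leq_trans jk kl) (leq_trans ij (leq_trans jk kl)).
have ilt : (s <= i -> s <= j)%N by move=> /leq_trans; apply.
have lle : (l <= n -> k <= n)%N by exact: leq_trans.
case: (leqP s i) ilt => [_ /(_ isT) ->|_ _];
  case: (leqP l n) lle => [_ /(_ isT) ->|_ _] //=.
- by case: (leqP k n) => /=; lia.
- by case: (s <= j)%N => /=; lia.
- by case: (s <= j)%N => /=; case: (leqP k n) => /=; lia.
Qed.

Section Grid.
Variables (R : realType) (C : ranked_category) (F : functor (real_cat R) C).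
Variables (w : nat -> R) (n : nat).

Definition fine_grid : Prop :=
  [/\ (1 < n)%N,
      forall i, w i < w i.+1,
      forall i x y, ~ regular_value F x -> ~ regular_value F y ->
        w i <= x <= w i.+1 -> w i <= y <= w i.+1 -> x = y,
      forall i, regular_value F (w i) &
      (forall x, x <= w 1%N -> regular_value F x) /\
      (forall x, w n <= x -> regular_value F x)].

Hypothesis fine : fine_grid.

(** Cell [i] lies between the indices [i] and [i.+1]. Cells 0 and [n] cross the border of the
    window, so they hold the infinite coordinates. *)
Definition critical_in_cell (i : nat) (u : \bar R) : Prop :=
  match u with
  | x%:E => [/\ ~ regular_value F x, (0 < i < n)%N & w i < x < w i.+1]
  | -oo%E => i = 0%N
  | +oo%E => i = n
  end.

Lemma grid_le i j : (i <= j)%N -> w i <= w j.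
Proof.
have [_ wlt _ _ _] := fine; elim: j => [|j IHj].
  by rewrite leqn0 => /eqP ->.
by rewrite leq_eqVlt => /predU1P[->//|/IHj/le_trans]; apply; exact: ltW.
Qed.

Lemma critical_in_cell_leq i u : critical_in_cell i u -> (i <= n)%N.
Proof.
by case: u => [x [_ /andP[_ /ltnW]]| ->|->].
Qed.

Lemma critical_in_cell_lt i j u v : critical_in_cell i u ->
  critical_in_cell j v -> (i < j)%N -> (u < v)%E.
Proof.
have [n1 _ _ _ _] := fine.
move=> iu jv ij; have jn := critical_in_cell_leq jv.
case: u v iu jv => [x||] [y||] //=.
- move=> [_ _ /andP[_ xi]] [_ _ /andP[jy _]]; rewrite lte_fin.
  by rewrite (lt_trans xi)// (le_lt_trans _ jy)// grid_le.
- by move=> _ _; exact: ltry.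
- by move=> _ j0; rewrite j0 in ij.
- by move=> iN _; move: (leq_trans ij jn); rewrite iN ltnn.
- by move=> iN _; move: (leq_trans ij jn); rewrite iN ltnn.
- by move=> iN _; move: (leq_trans ij jn); rewrite iN ltnn.
- by move=> _ _; exact: ltNyr.
- by move=> _ j0; rewrite j0 in ij.
Qed.

Lemma critical_in_cell_inj i u v : critical_in_cell i u ->
  critical_in_cell i v -> u = v.
Proof.
have [n1 _ uniq_crit _ _] := fine.
case: u v => [x||] [y||] //=; try by move=> ? ?; exfalso; lia.
- move=> [cx _ /andP[/ltW wx /ltW xw]] [cy _ /andP[/ltW wy /ltW yw]].
  by congr _%:E; apply: (uniq_crit i) => //; apply/andP.
- by move=> [_ ? _] ?; exfalso; lia.
- by move=> [_ ? _] ?; exfalso; lia.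
- by move=> ? [_ ? _]; exfalso; lia.
- by move=> ? [_ ? _]; exfalso; lia.
Qed.

Lemma critical_in_cell_unique i j u : critical_in_cell i u ->
  critical_in_cell j u -> i = j.
Proof.
move=> iu ju; have [ij|ji|//] := ltngtP i j.
  by have := critical_in_cell_lt iu ju ij; rewrite ltxx.
by have := critical_in_cell_lt ju iu ji; rewrite ltxx.
Qed.

Lemma critical_in_cell_ex x : ~ regular_value F x ->
  exists i, critical_in_cell i x%:E.
Proof.
have [n1 wlt _ regw [regl regr]] := fine; move=> cx.
have w1x : w 1%N <= x by rewrite leNgt; apply/negP => /ltW/regl.
pose P i := ((i <= n)%N && (w i <= x)).
have exP : exists i, P i by exists 1%N; rewrite /P w1x ltnW.
have bP i : P i -> (i <= n)%N by case/andP.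
case: (ex_maxnP exP bP) => i /andP[lein wix] imax; exists i.
have nreg j : x != w j by apply/eqP => xw; apply: cx; rewrite xw.
have i0 : (0 < i)%N by apply: imax; rewrite /P w1x ltnW.
have ltin : (i < n)%N.
  by rewrite ltn_neqAle lein andbT; apply/eqP => iN; apply/cx/regr; rewrite -iN.
split=> //; first by rewrite i0.
rewrite lt_neqAle wix eq_sym nreg/= ltNge; apply/negP => wix1.
by have := imax i.+1; rewrite /P ltin wix1 ltnn => /(_ isT).
Qed.

Variable m : int.
Hypothesis min_m : m <= min_rank F.

Let q := window 1 n m (fun i j => prank F (w i) (w j)).

(** The extended grid that matches [window]: [ew i] and [ew i.+1] isolate the coordinate in cell
    [i]. *)
Let ew (i : nat) : \bar R :=
  if (0 < i)%N then if (i <= n)%N then (w i)%:E else +oo%E else -oo%E.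

Lemma critical_in_cell_isolates i u : critical_in_cell i u ->
  isolates F (ew i) u (ew i.+1).
Proof.
have [n1 wlt uniq_crit regw [regl regr]] := fine.
case: u => [x [cx /andP[i0 ltin] /andP[wx xw]]|->|->]; rewrite /ew.
- rewrite i0 ltin (ltnW ltin) /= wx xw; split=> // y wyw yx.
  apply: contrapT => cy; move/eqP: yx; apply; apply: (uniq_crit i) => //.
  by rewrite !ltW.
- by rewrite (ltnW n1) leqnn ltnn /=.
- by rewrite /= (ltnW n1).
Qed.

Lemma window_prank_box_ge0 : box_ge0 q.
Proof.
apply: window_box_ge0 => [i j ij|i j k l /andP[ij jk] kl|i j k l /andP[ij jk] kl].
- by apply: le_trans min_m _; apply: (min_rankP F).2; exact: grid_le.
- by apply: prank_sub; exact: grid_le.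
- by apply: prank_box; exact: grid_le.
Qed.

(** Off the corner [(0, n)] both [m] and [min_rank F] cancel from the second differences, so a
    single bound [m] can serve [F], [G] and all the sequences between them. *)
Lemma cell_mult_multiplicity i j u v : critical_in_cell i u ->
  critical_in_cell j v -> (i < j)%N -> (i, j) != (0%N, n) ->
  (cell_mult q (i, j))%:Z = multiplicity F u v.
Proof.
have [n1 _ _ _ _] := fine.
move=> iu jv ij ijn; have jn := critical_in_cell_leq jv.
have uv := critical_in_cell_lt iu jv ij.
have ewij : (ew i.+1 <= ew j)%E.
  by rewrite /ew /= (leq_trans ij) ?jn ?(leq_ltn_trans _ ij)//= lee_fin grid_le.
rewrite (multiplicity_isolates (critical_in_cell_isolates iu)
  (critical_in_cell_isolates jv))//.
rewrite cell_multE//=; last exact: window_prank_box_ge0.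
have i1n := leq_trans ij jn; have j0 := leq_ltn_trans (leq0n i) ij.
rewrite /ebox /q /window /ew /= i1n j0 jn ij (ltnW ij) (ltnW i1n) /=.
rewrite (leq_trans ij (leqnSn j)) (leq_trans (ltnW ij) (leqnSn j)).
case: (posnP i) ijn => [->|i0] ijn /=.
  have -> : (j < n)%N by rewrite ltn_neqAle jn andbT; apply: contra ijn => /eqP ->.
  by rewrite /=; lia.
by case: (ltnP j n) => jn' /=; lia.
Qed.

Lemma multiplicity_critical_in_cell u v : (u < v)%E ->
  0 < multiplicity F u v -> exists i j, [/\ critical_in_cell i u,
    critical_in_cell j v, (i < j)%N & (i, j) != (0%N, n)].
Proof.
have [n1 wlt uniq_crit regw [regl regr]] := fine.
move=> uv uv0.
have [i iu] : exists i, critical_in_cell i u.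
  case: u uv uv0 => [x||] uv uv0.
  - apply: critical_in_cell_ex => rx.
    by rewrite multiplicity_regularl in uv0.
  - by exists n.
  - by exists 0%N.
have [j jv] : exists j, critical_in_cell j v.
  case: v uv uv0 => [x||] uv uv0.
  - apply: critical_in_cell_ex => rx.
    by rewrite multiplicity_regularr in uv0.
  - by exists n.
  - by exists 0%N.
exists i, j; split=> //.
  have [//|ji|ij] := ltngtP i j.
    by move: (critical_in_cell_lt jv iu ji); rewrite ltNge (ltW uv).
  by rewrite ij in iu; move: uv; rewrite (critical_in_cell_inj iu jv) ltxx.
apply/eqP => -[i0 jn].
have u_ : u = -oo%E.
  by apply: (@critical_in_cell_inj i) => //=.
have v_ : v = +oo%E.
  by apply: (@critical_in_cell_inj j) => //=.
move: uv0; rewrite u_ v_ (@multiplicity_infinite _ _ _ (w 1%N) (w n))//.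
by apply: grid_le; exact: ltnW.
Qed.

(** [F] is constant across a cell without critical value, so the second difference vanishes
    there. *)
Lemma cell_mult_critical_in_cell i j : (i < j)%N -> (i, j) != (0%N, n) ->
  (0 < cell_mult q (i, j))%N ->
  exists u v, critical_in_cell i u /\ critical_in_cell j v.
Proof.
have [n1 wlt uniq_crit regw [regl regr]] := fine.
have regular_cell k : (0 < k < n)%N ->
    (exists u, critical_in_cell k u) \/ const_between F (w k) (w k.+1).
  move=> kn; have [|no] := pselect (exists u, critical_in_cell k u); [by left|right].
  apply: regular_const_between => [|x /andP[wx xw]]; first exact/ltW.
  apply: contrapT => cx; apply: no; exists x%:E; split=> //.
  have xw' l : x != w l by apply/eqP => xl; apply: cx; rewrite xl.
  by rewrite lt_neqAle wx lt_neqAle xw eq_sym !xw'.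
move=> ij ijn; rewrite -ltz_nat cell_multE//=; last exact: window_prank_box_ge0.
have j0 := leq_ltn_trans (leq0n i) ij.
rewrite /q /window /= ij (ltnW ij) (leq_trans ij (leqnSn j)).
rewrite (leq_trans (ltnW ij) (leqnSn j)) /=.
have [jn|jn|jn] := ltngtP j n.
- have [[v jv]|/const_between_prankr pj] := regular_cell j ltac:(by rewrite j0).
    case: (posnP i) => [-> _|i0]; first by exists -oo%E, v.
    have [[u iu]|] := regular_cell i ltac:(by rewrite i0 (ltn_trans ij)).
      by move=> _; exists u, v.
    move=> /const_between_prankl pi; rewrite /=.
    rewrite !pi ?grid_le//; first by lia.
    by rewrite (leq_trans ij).
  by rewrite !pj ?grid_le// ?(ltnW ij)//; case: (0 < i)%N => /=; lia.
- by rewrite !andbF; lia.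
- have i0 : (0 < i)%N.
    by move: ijn; rewrite lt0n; apply: contra => /eqP ->; rewrite jn.
  have [[u iu]|] := regular_cell i ltac:(by rewrite i0 -jn).
    by move=> _; exists u, +oo%E; split.
  move=> /const_between_prankl pi.
  by rewrite i0 /= (pi (w j)) ?grid_le//; lia.
Qed.

End Grid.

(** * Interpolating sequences *)

Section InterpolationRank.
Variables (R : realType) (C : ranked_category) (F G : functor (real_cat R) C).
Variables (e d z : R) (N : nat).
Hypotheses (d_ge0 : 0 <= d) (edN : e = d * N%:R).
Hypothesis colims : has_finite_colimits C.
Variables (phi : nat_trans F (fcomp G (shift e))).
Variables (psi : nat_trans G (fcomp F (shift e))).
Hypothesis psi_phi : forall (a : R) (h : a <= a + e + e),
  psi (a + e) \c phi a = @fmap _ _ F a (a + e + e) h.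
Hypothesis phi_psi : forall (a : R) (h : a <= a + e + e),
  phi (a + e) \c psi a = @fmap _ _ G a (a + e + e) h.

Let H := interp colims phi psi.

Let e_ge0 : 0 <= e. Proof. by rewrite edN mulr_ge0. Qed.

Lemma thin_rank_interpl (c c' : R * R) : prod_le c c' -> c.2 <= c.1 - e ->
  c'.2 <= c'.1 - e -> thin_rank H c c' = prank F c.1 c'.1.
Proof.
move=> cc' cle c'le; have /andP[h1 h2] := cc'.
have [b [bl lb]] := interp_inl_iso colims psi_phi e_ge0 cle.
have [b' [bl' lb']] := interp_inl_iso colims psi_phi e_ge0 c'le.
rewrite (thin_rankE H cc') (prankE F h1).
apply: (@rank_image_iso C _ _ _ _ _ _ _ _ _ _ lb bl').
by have [] := interp_mapP colims phi psi cc' h1 h2.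
Qed.

Lemma thin_rank_interpr (c c' : R * R) : prod_le c c' -> c.1 <= c.2 - e ->
  c'.1 <= c'.2 - e -> thin_rank H c c' = prank G c.2 c'.2.
Proof.
move=> cc' cle c'le; have /andP[h1 h2] := cc'.
have [b [bl lb]] := interp_inr_iso colims phi_psi e_ge0 cle.
have [b' [bl' lb']] := interp_inr_iso colims phi_psi e_ge0 c'le.
rewrite (thin_rankE H cc') (prankE G h2).
apply: (@rank_image_iso C _ _ _ _ _ _ _ _ _ _ lb bl').
by have [] := interp_mapP colims phi psi cc' h1 h2.
Qed.

(* The [t]-th interpolating sequence is [H (path t 0)], [H (path t 1)], ...;
   for [t = 0] it is a restriction of [F] and for [t = 2 N] one of [G]. *)
Let path (t i : nat) : R * R :=
  (z + d * i%:R, z + d * (i%:R + t%:R - N%:R)).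

(* The sequences [path t] and [path t.+1] interlaced. *)
Let staircase (t i : nat) : R * R :=
  (z + d * i./2%:R, z + d * ((uphalf i)%:R + t%:R - N%:R)).

(** For [t = 0] the second coordinate of [path] is the first minus [e], where the interpolation is
    [F]; for [t = N.*2] it is the first plus [e], where it is [G], read on the grid shifted by
    [N]. *)
Lemma interp_cell_matching (n : nat) (m : int) :
  (forall X : C, m <= rank X) ->
  cell_matching N.*2
    (window 1 n m (fun i j => prank F (z + d * i%:R) (z + d * j%:R)))
    (window 1 n m (fun i j => prank G (z + d * (i + N)%:R) (z + d * (j + N)%:R))).
Proof.
move=> mrank.
pose q t := window 1 n m (fun i j => thin_rank H (path t i) (path t j)).
have path_le t i j : (i <= j)%N -> prod_le (path t i) (path t j).
  move=> ij; rewrite /prod_le /= !lerD2l !ler_wpM2l ?ler_nat//.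
  by rewrite !lerD2r ler_nat.
have -> : window 1 n m (fun i j => prank F (z + d * i%:R) (z + d * j%:R)) = q 0%N.
  apply/funext => i; apply/funext => j; rewrite /q /window.
  case: ifP => // /and3P[_ ij _]; rewrite thin_rank_interpl//=; first exact: path_le.
    by rewrite edN; lra.
  by rewrite edN; lra.
have -> : window 1 n m
    (fun i j => prank G (z + d * (i + N)%:R) (z + d * (j + N)%:R)) = q N.*2.
  apply/funext => i; apply/funext => j; rewrite /q /window.
  have E (k : nat) : k%:R + N.*2%:R - N%:R = (k + N)%:R :> R.
    by rewrite -addnn !natrD; lra.
  case: ifP => // /and3P[_ ij _]; rewrite thin_rank_interpr//= ?E//; first exact: path_le.
    by rewrite edN natrD; lra.
  by rewrite edN natrD; lra.
apply: cell_matching_iter => t _.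
have stair_le i j : (i <= j)%N -> prod_le (staircase t i) (staircase t j).
  move=> ij; rewrite /prod_le /= !lerD2l !ler_wpM2l// ?ler_nat ?half_leq//.
  by rewrite !lerD2r ler_nat uphalf_leq.
(* Both [2 i] and [2 i + 1] lie between 2 and [2 n + 1] exactly when [i] lies between 1 and [n].
   Rows 0 and 1 fall outside the window, hence agree. *)
exists (window 2 n.*2.+1 m (fun i j => thin_rank H (staircase t i) (staircase t j))).
split.
- apply: window_box_ge0 => [i j ij|i j k l /andP[ij jk] kl|i j k l /andP[ij jk] kl].
  + by rewrite (thin_rankE H (stair_le _ _ ij)).
  + by apply: thin_rank_sub; exact: stair_le.
  + by apply: thin_rank_box; exact: stair_le.
- by [].
- apply/funext => i; apply/funext => j; rewrite /q /window.
  rewrite leq_double -[2%N]/(1.*2) leq_double.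
  have -> : (j.*2 <= n.*2.+1)%N = (j <= n)%N by lia.
  by rewrite /staircase !doubleK !uphalf_double.
- apply/funext => i; apply/funext => j; rewrite /q /window.
  rewrite !ltnS !leq_double double_gt0.
  rewrite /staircase /path /= !uphalf_double !doubleK.
  have E (k : nat) : k%:R + t.+1%:R - N%:R = k.+1%:R + t%:R - N%:R :> R.
    by rewrite -(addn1 t) -(addn1 k) !natrD; lra.
  by rewrite !E.
Qed.

End InterpolationRank.

(** * Fine grids *)

Lemma finite_set_has_ubound (R : realType) (S : set R) : finite_set S ->
  exists M, forall x, S x -> x <= M.
Proof.
move=> /finite_seqP[s ->]; elim: s => [|a s [M sM]]; first by exists 0.
exists (Num.max a M) => x /=; rewrite inE => /predU1P[->|/sM xM].
  by rewrite le_max lexx.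
by rewrite le_max xM orbT.
Qed.

(** The gap is the inverse of an upper bound for the inverse distances; coinciding points contribute
    only 0. *)
Lemma finite_set_gap (R : realType) (S : set R) : finite_set S ->
  exists2 g, 0 < g & forall x y, S x -> S y -> `|x - y| < g -> x = y.
Proof.
move=> finS.
have [M MP] : exists M, forall t, ((fun p => `|p.1 - p.2|^-1) @` (S `*` S)) t -> t <= M.
  by apply: finite_set_has_ubound; apply: finite_image; exact: finite_setX.
exists (Num.max M 1)^-1 => [|x y Sx Sy xyg].
  by rewrite invr_gt0 lt_max ltr01 orbT.
apply/eqP; rewrite -subr_eq0 -normr_eq0; apply/negP => /negP xy.
have xy0 : 0 < `|x - y| by rewrite lt_def xy normr_ge0.
have /MP : ((fun p : R * R => `|p.1 - p.2|^-1) @` (S `*` S)) `|x - y|^-1 by exists (x, y).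
rewrite leNgt => /negP; apply.
have : `|x - y|^-1^-1 < (Num.max M 1)^-1 by rewrite invrK.
rewrite ltf_pV2 ?posrE ?invr_gt0//; last by rewrite lt_max ltr01 orbT.
by rewrite gt_max => /andP[].
Qed.

Lemma finite_set_avoid (R : realType) (S : set R) (d : R) : finite_set S ->
  0 < d -> exists t, [/\ 0 < t, t < d & ~ S t].
Proof.
move=> finS d0.
have [M MP] : exists M, forall t, (GRing.inv @` S) t -> t <= M.
  by apply: finite_set_has_ubound; exact: finite_image.
pose T := Num.max M d^-1 + 1.
have dT : d^-1 < T by rewrite ltr_pwDr// le_max lexx orbT.
have T0 : 0 < T by rewrite (lt_trans _ dT)// invr_gt0.
exists T^-1; split; first by rewrite invr_gt0.
  by rewrite -[ltRHS]invrK ltf_pV2// ?posrE// invr_gt0.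
move=> ST; have : T <= M by apply: MP; exists T^-1 => //; rewrite invrK.
by rewrite leNgt ltr_pwDr// le_max lexx.
Qed.

Lemma fine_grids_ex (R : realType) (C : ranked_category)
    (F G : functor (real_cat R) C) (e eta : R) :
  tame F -> tame G -> 0 < e -> 0 < eta ->
  exists (N : nat) (d z : R) (n : nat),
    [/\ 0 < d <= eta, e = d * N%:R /\ (N.*2 < n)%N,
      fine_grid F (fun i => z + d * i%:R) n,
      fine_grid G (fun i => z + d * (i + N)%:R) n &
      forall x, ~ regular_value F x \/ ~ regular_value G x ->
        z + 3 * (e + d) < x /\ x + 3 * (e + d) < z + d * n%:R].
Proof.
move=> tF tG e0 eta0.
pose K := [set x | ~ regular_value F x] `|` [set x | ~ regular_value G x].
have finK : finite_set K by rewrite finite_setU.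
have [g g0 gP] := finite_set_gap finK.
have [M MP] : exists M, forall t, (Num.norm @` K) t -> t <= M.
  by apply: finite_set_has_ubound; exact: finite_image.
have {}MP x : K x -> - (Num.max M 0) <= x <= Num.max M 0.
  by move=> Kx; rewrite -ler_norml le_max MP//; exists x.
have : 0 <= Num.max M 0 by rewrite le_max lexx orbT.
move: (Num.max M 0) MP => {}M MP M0.
(* A step of at most half the gap leaves room for only one critical value per cell. *)
pose s := Num.min eta (g / 2).
have s0 : 0 < s by rewrite lt_min eta0 divr_gt0.
pose N := (Num.bound (e / s)).+1.
have N0 : 0 < N%:R :> R by rewrite ltr0n.
pose d := e / N%:R.
have d0 : 0 < d by rewrite divr_gt0.
have ds : d <= s.
  rewrite ler_pdivrMr// mulrC -ler_pdivrMr//; apply: ltW.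
  apply: lt_trans (archi_boundP _) _; first by rewrite divr_ge0// ltW.
  by rewrite ltr_nat.
have edN : e = d * N%:R by rewrite divfK// gt_eqF.
(* All critical values lie between [- M] and [M]; [c] and [n] leave a margin above [3 * (e + d)] on
   both sides, even after a shift of [c] by less than [d]. *)
pose c := - M - 3 * (e + d) - d.
pose n := (Num.bound `|(2 * M + 6 * (e + d) + 3 * d) / d|).+2.
have dn : 2 * M + 6 * (e + d) + 3 * d < d * n%:R.
  rewrite [ltRHS]mulrC -ltr_pdivrMr//; apply: le_lt_trans (ler_norm _) _.
  by rewrite (lt_trans (archi_boundP (normr_ge0 _)))// /n ltr_nat.
(* The shift [t] keeps critical values off the first [n] grid points; the later grid points are
   above all critical values. *)
have [t [t0 td nt]] := @finite_set_avoid R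
  ((fun p : R * nat => c + d * p.2%:R - p.1) @` (K `*` `I_n)) d
  ltac:(by apply: finite_image; apply: finite_setX) d0.
pose z := c - t; exists N, d, z, n.
have marg x : K x -> z + 3 * (e + d) < x /\ x + 3 * (e + d) < z + d * n%:R.
  by move=> /MP/andP[? ?]; rewrite /z /c; split; lra.
have regz i x : K x -> x != z + d * i%:R.
  move=> Kx; apply/eqP => xz; have [ltin|lein] := ltnP i n.
    by apply: nt; exists (x, i) => //=; rewrite xz /z; lra.
  have [_] := marg x Kx; rewrite xz ltNge => /negP; apply.
  have : d * n%:R <= d * i%:R by rewrite ler_wpM2l ?ler_nat// ltW.
  lra.
have fine F' k : (forall x, ~ regular_value F' x -> K x) -> (k <= N)%N ->
    fine_grid F' (fun i => z + d * (i + k)%:R) n.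
  move=> F'K kN.
  have dk : d * k%:R <= e by rewrite edN ler_wpM2l ?ler_nat// ltW.
  have dk0 : 0 <= d * k%:R by rewrite mulr_ge0// ltW.
  split=> //.
  - by move=> i; rewrite ltrD2l ltr_pM2l// ltr_nat.
  - move=> i x y /F'K Kx /F'K Ky; rewrite !natrD mulrDr mulrDr -(addn1 i) natrD.
    rewrite mulrDr mulr1 => /andP[? ?] /andP[? ?]; apply: gP => //.
    have : d <= g / 2 by rewrite (le_trans ds)// ge_min lexx orbT.
    by rewrite ltr_norml => ?; lra.
  - by move=> i; apply: contrapT => /F'K/(regz (i + k)%N)/eqP.
  - split=> x xz; apply: contrapT => /F'K/marg[].
      by rewrite natrD in xz *; lra.
    by rewrite natrD in xz *; lra.
split=> //.
- by rewrite d0 (le_trans ds)// ge_min lexx.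
- split=> //; rewrite -(ltr_nat R) -addnn natrD -(ltr_pM2l d0) mulrDr -edN.
  by lra.
- rewrite (_ : (fun i => _) = fun i => z + d * (i + 0)%:R); last first.
    by apply/funext => i; rewrite addn0.
  by apply: fine => // x; left.
- by apply: fine => // x; right.
Qed.

(** * Injections between diagrams *)

Lemma triple_eq (T U V : Type) (p q : T * U * V) :
  p.1.1 = q.1.1 -> p.1.2 = q.1.2 -> p.2 = q.2 -> p = q.
Proof. by case: p q => [[? ?] ?] [[? ?] ?] /= -> -> ->. Qed.

Section OneSidedMatching.
Variables (R : realType) (C : ranked_category) (F G : functor (real_cat R) C).
Variables (e d z : R) (N n : nat).
Hypothesis d_gt0 : 0 < d.
Hypotheses (edN : e = d * N%:R) (N2n : (N.*2 < n)%N).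
Hypothesis fineF : fine_grid F (fun i => z + d * i%:R) n.
Hypothesis fineG : fine_grid G (fun i => z + d * (i + N)%:R) n.
Hypothesis margin : forall x, ~ regular_value F x \/ ~ regular_value G x ->
  z + 3 * (e + d) < x /\ x + 3 * (e + d) < z + d * n%:R.

Let cellF := critical_in_cell F (fun i => z + d * i%:R) n.
Let cellG := critical_in_cell G (fun i => z + d * (i + N)%:R) n.

Let ltd (a b : nat) : d * a%:R < d * b%:R -> (a < b)%N.
Proof. by rewrite ltr_pM2l// ltr_nat. Qed.

Let e_ge0 : 0 <= e.
Proof. by rewrite edN mulr_ge0// ltW. Qed.

(** The index drift lies between 0 and [N.*2], and the grid of [G] is shifted by [N], so the net
    drift is at most [N] steps either way, plus one cell width. The margin of [3 * (e + d)] covers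
    shift and drift together, so finite and infinite coordinates are never paired. *)
Lemma near_cell_coord_dist i i' (u u' : \bar R) : cellF i u -> cellG i' u' ->
  (i' <= i)%N -> (i <= i' + N.*2)%N -> (coord_dist u u' <= (e + d)%:E)%E.
Proof.
have [n1 _ _ _ _] := fineF.
have e0 := e_ge0; have d0 := d_gt0; have ed0 : 0 <= e + d by rewrite addr_ge0// ltW.
case: u u' => [x||] [x'||] //=.
- move=> [cx _ /andP[wx xw]] [cx' _ /andP[wx' xw']] i'i ii'.
  rewrite lee_fin; move: wx xw wx' xw'.
  rewrite -(addn1 i) -(addn1 i') !natrD !mulrDr mulr1 -edN.
  have : d * i'%:R <= d * i%:R by rewrite ler_wpM2l ?ler_nat// ltW.
  have : d * i%:R <= d * (i' + N.*2)%:R by rewrite ler_wpM2l ?ler_nat// ltW.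
  rewrite -addnn !natrD !mulrDr -edN ler_norml => *; apply/andP; split; lra.
- by move=> [_ ? _] ? ? _; exfalso; lia.
- move=> [cx _ /andP[_ xw]] i'0 _ ii'; exfalso.
  have [zx _] := margin (or_introl cx).
  have /ltd : d * (i' + (N + N) + 1)%:R < d * i.+1%:R.
    rewrite i'0 add0n !natrD !mulrDr -edN mulr1; lra.
  lia.
- move=> iN [cx' _ /andP[xw _]] _ ii'; exfalso.
  have [_ zx] := margin (or_intror cx').
  have /ltd : d * (i' + N + (N + N))%:R < d * n%:R.
    by rewrite 3!natrD !mulrDr -edN; rewrite natrD mulrDr -edN in xw; lra.
  lia.
- by move=> iN i'0 _ ii'; exfalso; lia.
- by move=> i0 [_ ? _] ? _; exfalso; lia.
- by move=> *; exfalso; lia.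
Qed.

(** Points that can move to the diagonal, at their midpoint, at cost at most [e + d]. *)
Definition close_points (u v : \bar R) : Prop :=
  exists x y, [/\ u = x%:E, v = y%:E & y - x <= 2 * (e + d)].

Lemma far_cells i j (u v : \bar R) : cellF i u -> cellF j v -> (i < j)%N ->
  (i, j) != (0%N, n) -> ~ close_points u v -> (i + N.*2 < j)%N.
Proof.
have [n1 _ _ _ _] := fineF; have e0 := e_ge0; have d0 := d_gt0; move=> iu jv ij ijn far.
have jn := critical_in_cell_leq jv.
case: u iu far => [x||] /=.
- move=> [cx _ /andP[wx xw]] far.
  case: v jv far => [y||] /=.
  + move=> [cy _ /andP[wy yw]] far; rewrite -addnn.
    have xy : 2 * (e + d) < y - x.
      by rewrite ltNge; apply/negP => xy; apply: far; exists x, y.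
    have /ltd : d * (i + (N + N) + 1)%:R < d * j.+1%:R.
      by rewrite 3!natrD !mulrDr -edN; lra.
    lia.
  + move=> jN _; rewrite -addnn; have [_ zx] := margin (or_introl cx).
    by apply: ltd; rewrite !natrD !mulrDr -edN jN; lra.
  + by move=> j0; exfalso; lia.
- by move=> iN; exfalso; lia.
- move=> i0; case: v jv => [y||] /=.
  + move=> [cy _ /andP[wy yw]] _; have [zy _] := margin (or_introl cy).
    have /ltd : d * (i + (N + N) + 1)%:R < d * j.+1%:R.
      by rewrite i0 add0n !natrD !mulrDr -edN; lra.
    lia.
  + by move=> jN; move: ijn; rewrite i0 jN eqxx.
  + by move=> j0; exfalso; lia.
Qed.

Variable m : int.
Hypotheses (mF : m <= min_rank F) (mG : m <= min_rank G).
Hypothesis matching : cell_matching N.*2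
  (window 1 n m (fun i j => prank F (z + d * i%:R) (z + d * j%:R)))
  (window 1 n m (fun i j => prank G (z + d * (i + N)%:R) (z + d * (j + N)%:R))).

Let off_diagonal (K : functor (real_cat R) C) (q : \bar R * \bar R * nat) :=
  (q.1.1 < q.1.2)%E /\ q.2%:Z < multiplicity K q.1.1 q.1.2.

Let off_diagonal_cells (q : \bar R * \bar R * nat) : off_diagonal F q ->
  exists i j, [/\ cellF i q.1.1, cellF j q.1.2, (i < j)%N & (i, j) != (0%N, n)].
Proof.
move=> [uv km]; apply: multiplicity_critical_in_cell => //.
exact: le_lt_trans km.
Qed.

(** A point that is not close has cells more than [N.*2] apart, so the cell matching applies to it;
    cells and copy numbers determine the points on both sides. *)
Lemma far_points_matching : exists M : \bar R * \bar R * nat ->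
    \bar R * \bar R * nat -> Prop,
  (forall q, off_diagonal F q -> ~ close_points q.1.1 q.1.2 ->
    exists q', [/\ M q q', off_diagonal G q' &
      (point_dist q.1 q'.1 <= (e + d)%:E)%E]) /\
  (forall q1 q2 q', off_diagonal F q1 -> ~ close_points q1.1.1 q1.1.2 ->
    off_diagonal F q2 -> ~ close_points q2.1.1 q2.1.2 ->
    M q1 q' -> M q2 q' -> q1 = q2).
Proof.
have [phi [phiP phi_inj]] := matching.
have valid q i j : off_diagonal F q -> ~ close_points q.1.1 q.1.2 ->
    cellF i q.1.1 -> cellF j q.1.2 ->
    [/\ is_copy (window 1 n m (fun i j => prank F (z + d * i%:R) (z + d * j%:R)))
          ((i, j), q.2), (i + N.*2 < j)%N & (i, j) != (0%N, n)].
  move=> oq far iu jv.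
  have [i' [j' [iu' jv' ij ijn]]] := off_diagonal_cells oq.
  have ii' := critical_in_cell_unique fineF iu' iu.
  have jj' := critical_in_cell_unique fineF jv' jv.
  rewrite {}ii' {}jj' in ij ijn; split=> //; last exact: far_cells far.
  rewrite /is_copy /= -ltz_nat.
  by rewrite (cell_mult_multiplicity fineF mF iu jv)//; exact: oq.2.
exists (fun q q' => exists i j i' j', [/\ cellF i q.1.1, cellF j q.1.2,
  cellG i' q'.1.1 /\ cellG j' q'.1.2 & phi ((i, j), q.2) = ((i', j'), q'.2)]).
split=> [q oq far|q1 q2 q' oq1 far1 oq2 far2].
  have [i [j [iu jv ij ijn]]] := off_diagonal_cells oq.
  have [copy ijN _] := valid _ _ _ oq far iu jv.
  have := phiP _ copy ijN; case phiE: (phi _) => [[i' j'] k'] /=.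
  move=> [copy' /and4P[/= a1 a2 a3 a4]].
  have i'j' : (i' < j')%N by lia.
  (* The corner cell carries no point of [G]. If it were the image, the finite distance bounds would
     make both coordinates of [q] infinite, and [(i, j)] would be the corner as well. *)
  have i'j'n : (i', j') != (0%N, n).
    apply/eqP => -[i'0 j'n].
    have : cellG i' -oo%E by exact: i'0.
    move=> /(near_cell_coord_dist iu)/(_ a1 a2) distu.
    have : cellG j' +oo%E by exact: j'n.
    move=> /(near_cell_coord_dist jv)/(_ a3 a4) distv.
    case: q iu jv distu distv {copy oq far phiE} => [[[x||] [y||]] k] //= i0 jn _ _.
    by move: ijn; rewrite i0 jn eqxx.
  have [u' [v' [iu' jv']]] := cell_mult_critical_in_cell fineG mG i'j' i'j'n
    (leq_ltn_trans (leq0n _) copy').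
  exists (u', v', k'); split.
  - by exists i, j, i', j'.
  - split=> /=; first exact: (critical_in_cell_lt fineG iu' jv' i'j').
    by rewrite -(cell_mult_multiplicity fineG mG iu' jv').
  rewrite /point_dist /= ge_max (near_cell_coord_dist iu iu')//.
  exact: (near_cell_coord_dist jv jv').
move=> [i1 [j1 [i' [j' [iu1 jv1 [iu' jv'] phi1]]]]].
move=> [i2 [j2 [i2' [j2' [iu2 jv2 [iu2' jv2'] phi2]]]]].
move: phi2; rewrite (critical_in_cell_unique fineG iu2' iu').
rewrite (critical_in_cell_unique fineG jv2' jv') -phi1 => phi12.
have [copy1 ij1 _] := valid _ _ _ oq1 far1 iu1 jv1.
have [copy2 ij2 _] := valid _ _ _ oq2 far2 iu2 jv2.
have [i12 j12 k12] := phi_inj _ _ copy2 ij2 copy1 ij1 phi12.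
rewrite i12 in iu2; rewrite j12 in jv2.
apply: triple_eq => //.
  exact: (critical_in_cell_inj fineF iu1 iu2).
exact: (critical_in_cell_inj fineF jv1 jv2).
Qed.

(** Far points follow the cell matching, close ones go to the diagonal at their midpoint, and
    diagonal ones keep their position. *)
Lemma one_sided_matching : exists f : \bar R * \bar R * nat -> \bar R * \bar R * nat,
  (forall q, diagram F q -> diagram G (f q) /\
     (point_dist q.1 (f q).1 <= (e + d)%:E)%E) /\
  {in diagram F &, injective f}.
Proof.
have [M [MP Minj]] := far_points_matching.
have e0 := e_ge0; have d0 := d_gt0; have ed0 : 0 <= e + d by rewrite addr_ge0// ltW.
(* Extended reals are uncountable, but cell numbers determine the coordinates of cornerpoints, so
   [code] numbers these points injectively. *)
pose idx u := xget 0%N [set i | cellF i u].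
have idxP i u : cellF i u -> cellF (idx u) u.
  by move=> iu; rewrite /idx; case: xgetP => [j _ //|/(_ i)].
pose code (q : \bar R * \bar R * nat) := pickle (idx q.1.1, idx q.1.2, q.2).
pose mid (q : \bar R * \bar R * nat) : \bar R :=
  ((fine q.1.1 + fine q.1.2) / 2)%:E.
(* The points of the diagonal move to copies with even indices, to make room for
   the points close to the diagonal at the odd indices. *)
pose f q := if pselect (q.1.1 = q.1.2) then (q.1, q.2.*2) else
  if pselect (close_points q.1.1 q.1.2) then (mid q, mid q, (code q).*2.+1) else
  xget q [set q' | [/\ M q q', off_diagonal G q' &
      (point_dist q.1 q'.1 <= (e + d)%:E)%E]].
have f_diag q x : q.1 = (x%:E, x%:E) -> f q = (q.1, q.2.*2).
  by move=> qx; rewrite /f; case: pselect => //; rewrite qx.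
have off_neq q : off_diagonal F q -> q.1.1 <> q.1.2.
  by move=> [+ _] q12; rewrite q12 ltxx.
have f_close q : off_diagonal F q -> close_points q.1.1 q.1.2 ->
    f q = (mid q, mid q, (code q).*2.+1).
  move=> oq cl; rewrite /f; case: pselect => [/(off_neq _ oq)//|?].
  by case: pselect.
have f_far q : off_diagonal F q -> ~ close_points q.1.1 q.1.2 ->
    [/\ M q (f q), off_diagonal G (f q) & (point_dist q.1 (f q).1 <= (e + d)%:E)%E].
  move=> oq far; rewrite /f; case: pselect => [/(off_neq _ oq)//|?].
  case: pselect => // ?; case: xgetP => [q' -> //|no].
  by have [q' Mq'] := MP _ oq far; case: (no q').
have diagE K q : diagram K q -> off_diagonal K q \/ exists x, q.1 = (x%:E, x%:E).
  by case=> [|[x qx]]; [left|right; exists x].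
have dist0 (x : R) : (point_dist (x%:E, x%:E) (x%:E, x%:E) <= (e + d)%:E)%E.
  by rewrite /point_dist /= subrr normr0 maxxx lee_fin.
exists f; split=> [q /diagE[oq|[x qx]]|].
- have [cl|far] := pselect (close_points q.1.1 q.1.2); last first.
    by have [_ ? ?] := f_far _ oq far; split=> //; left.
  rewrite f_close//; split; first by right; eexists.
  have [x [y [qx qy yx]]] := cl.
  have [] := oq; rewrite /mid /point_dist /= qx qy lte_fin => xy _.
  by rewrite ge_max /= !lee_fin !ler_norml; apply/andP; split; apply/andP; split; lra.
- rewrite (f_diag _ _ qx); split; first by right; exists x.
  by rewrite qx.
have far_nd q x k : off_diagonal F q -> ~ close_points q.1.1 q.1.2 ->
    f q <> (x, x, k).
  by move=> oq far fq; have [_ [+ _] _] := f_far _ oq far; rewrite fq ltxx.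
move=> q1 q2; rewrite !inE => /diagE[h1|[x1 qx1]] /diagE[h2|[x2 qx2]].
- have [c1|far1] := pselect (close_points q1.1.1 q1.1.2);
    have [c2|far2] := pselect (close_points q2.1.1 q2.1.2).
  + rewrite !f_close// => -[_ _] /double_inj/(pcan_inj pickleK)[u12 v12 k12].
    have [i1 [j1 [iu1 jv1 _ _]]] := off_diagonal_cells h1.
    have [i2 [j2 [iu2 jv2 _ _]]] := off_diagonal_cells h2.
    have iu := idxP _ _ iu1; have jv := idxP _ _ jv1.
    rewrite u12 in iu; rewrite v12 in jv; apply: triple_eq => //.
      exact: (critical_in_cell_inj fineF iu (idxP _ _ iu2)).
    exact: (critical_in_cell_inj fineF jv (idxP _ _ jv2)).
  + by rewrite (f_close q1)// => /esym/(far_nd _ _ _ h2 far2).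
  + by rewrite (f_close q2)// => /(far_nd _ _ _ h1 far1).
  + move=> f12; have [M1 _ _] := f_far _ h1 far1; have [M2 _ _] := f_far _ h2 far2.
    by rewrite -f12 in M2; exact: Minj M1 M2.
- rewrite (f_diag _ _ qx2) qx2.
  have [c1|far1] := pselect (close_points q1.1.1 q1.1.2); last first.
    by move=> /(far_nd _ _ _ h1 far1).
  by rewrite f_close// => -[_ _ /(congr1 odd)]; rewrite /= !odd_double.
- rewrite (f_diag _ _ qx1) qx1 => /esym.
  have [c2|far2] := pselect (close_points q2.1.1 q2.1.2); last first.
    by move=> /(far_nd _ _ _ h2 far2).
  by rewrite f_close// => -[_ _ /(congr1 odd)]; rewrite /= !odd_double.
- rewrite (f_diag _ _ qx1) (f_diag _ _ qx2) => -[].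
  by case: q1 q2 {qx1 qx2} => [? ?] [? ?] /= -> /double_inj ->.
Qed.

End OneSidedMatching.

(** * Bottleneck distances *)

(* The Cantor-Bernstein bijection agrees at each point with [f] or with the
   inverse of [g]. *)
Lemma Cantor_Bernstein_pointwise (T : Type) (A B : set T) (f g : T -> T)
    (P : T -> T -> Prop) :
  {in A &, injective f} -> {in B &, injective g} ->
  (forall a, A a -> B (f a) /\ P a (f a)) ->
  (forall b, B b -> A (g b) /\ P (g b) b) ->
  exists h, set_bij A B h /\ forall a, A a -> P a (h a).
Proof.
move=> finj ginj fAB gBA.
(* The orbits under [g \o f] of the points outside the image of [g]: the bijection is [f] on [X] and
   inverts [g] elsewhere. *)
pose X a := exists n x, [/\ A x, ~ (g @` B) x & a = iter n (g \o f) x].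
have XA a : X a -> A a.
  move=> [n [x [Ax _ ->]]]; elim: n => //= n IHn.
  by apply: (gBA _ _).1; apply: (fAB _ _).1.
have gB a : A a -> ~ X a -> exists b, B b /\ g b = a.
  move=> Aa Xa; apply: contrapT => nb; apply: Xa; exists 0%N, a; split=> //.
  by move=> [b Bb gba]; apply: nb; exists b.
have kex a : exists b, A a -> ~ X a -> B b /\ g b = a.
  have [[Aa nX]|no] := pselect (A a /\ ~ X a); last first.
    by exists a => Aa nX; case: no.
  by have [b bP] := gB a Aa nX; exists b.
have [k kP] := choice kex.
pose h a := if pselect (X a) then f a else k a.
have hX a : X a -> h a = f a by rewrite /h; case: pselect.
have hk a : ~ X a -> h a = k a by rewrite /h; case: pselect.
have fX a b : X a -> f a = b -> X (g b).
  by move=> [n [x [Ax nx ->]]] <-; exists n.+1, x.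
exists h; split; first split.
- move=> a Aa; have [Xa|nX] := pselect (X a).
    by rewrite hX//; exact: (fAB _ _).1.
  by rewrite hk//; exact: (kP _ _ _).1.
- move=> a a' /set_mem Aa /set_mem Aa'.
  have [Xa|nXa] := pselect (X a); have [Xa'|nXa'] := pselect (X a').
  + by rewrite !hX// => /finj; apply; exact/mem_set.
  + have [_ gk] := kP _ Aa' nXa'.
    by rewrite (hX a)// (hk a')// => /(fX _ _ Xa); rewrite gk.
  + have [_ gk] := kP _ Aa nXa.
    by rewrite (hk a)// (hX a')// => /esym/(fX _ _ Xa'); rewrite gk.
  + have [_ gk] := kP _ Aa nXa; have [_ gk'] := kP _ Aa' nXa'.
    by rewrite !hk// => /(congr1 g); rewrite gk gk'.
- move=> b Bb; have [Xg|nXg] := pselect (X (g b)); last first.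
    exists (g b); first exact: (gBA _ _).1.
    have [Bk gk] := kP _ (gBA _ Bb).1 nXg.
    by rewrite hk//; apply: ginj => //; exact/mem_set.
  have [[|n] [x [Ax nx gbx]]] := Xg.
    by case: nx; exists b.
  have Xn : X (iter n (g \o f) x) by exists n, x.
  exists (iter n (g \o f) x); first exact: XA.
  rewrite hX//; apply: ginj; rewrite ?mem_set//.
  exact: (fAB _ (XA _ Xn)).1.
move=> a Aa; have [Xa|nX] := pselect (X a); first by rewrite hX//; exact: (fAB _ _).2.
have [Bk gk] := kP _ Aa nX.
by rewrite hk// -{1}gk; exact: (gBA _ _).2.
Qed.

(** * Stability of the diagram in a single ranked category *)

Section Interleaved.
Variable R : realType.

Lemma interleaved_sym (C : category) (e : R) (F G : functor (real_cat R) C) :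
  interleaved e F G -> interleaved e G F.
Proof. by move=> [phi [psi [h1 h2]]]; exists psi, phi. Qed.

Lemma interleaved_le (C : category) (e e' : R) (F G : functor (real_cat R) C) :
  0 <= e -> e <= e' -> interleaved e F G -> interleaved e' F G.
Proof.
move=> e0 ee' [phi [psi [psi_phi phi_psi]]].
have se (a : R) : a + e <= a + e' by rewrite lerD2l.
have nat_shift (K L : functor (real_cat R) C) (t : nat_trans K (fcomp L (shift e)))
    (a b : real_cat R) (h : hom a b) :
    @fmap _ _ (fcomp L (shift e')) a b h \c (@fmap _ _ L _ _ (se a) \c t a) =
    (@fmap _ _ L _ _ (se b) \c t b) \c @fmap _ _ K a b h.
  rewrite -compmA -(ncompP t) /= !compmA -!fmapM.
  by congr (fmap L _ \c _); exact: bool_irrelevance.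
have comp_shift (K L : functor (real_cat R) C) (t : nat_trans K (fcomp L (shift e)))
    (t' : nat_trans L (fcomp K (shift e))) :
    (forall (a : R) (h : a <= a + e + e),
      t' (a + e) \c t a = @fmap _ _ K a (a + e + e) h) ->
    forall (a : R) (h : a <= a + e' + e'),
    (@fmap _ _ K _ _ (se (a + e')) \c t' (a + e')) \c
      (@fmap _ _ L _ _ (se a) \c t a) = @fmap _ _ K a (a + e' + e') h.
  move=> t't a h.
  have k : a + e + e <= a + e' + e by rewrite lerD2r.
  have k0 : a <= a + e + e by rewrite -addrA lerDl addr_ge0.
  rewrite -compmA [t' _ \c _]compmA -(ncompP t' (se a)) -[_ \c t' _ \c t a]compmA t't.
  by rewrite -!fmapM; congr fmap; exact: bool_irrelevance.
exists (NatTrans (nat_shift _ _ phi)), (NatTrans (nat_shift _ _ psi)).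
by split; exact: comp_shift.
Qed.

Lemma coord_dist_sym (u v : \bar R) : coord_dist u v = coord_dist v u.
Proof. by case: u v => [x||] [y||] //=; rewrite distrC. Qed.

Lemma point_dist_sym (p q : \bar R * \bar R) : point_dist p q = point_dist q p.
Proof. by rewrite /point_dist coord_dist_sym (coord_dist_sym p.2). Qed.

Lemma bottleneck_bijection_ex (C : ranked_category)
    (F G : functor (real_cat R) C) (e eta : R) :
  has_finite_colimits C -> tame F -> tame G -> 0 <= e -> 0 < eta ->
  interleaved e F G ->
  exists beta, set_bij (diagram F) (diagram G) beta /\
    forall q, diagram F q -> (point_dist q.1 (beta q).1 <= (e + eta)%:E)%E.
Proof.
move=> colims tF tG e0 eta0 FG.
(* Half of [eta] makes the interleaving parameter positive, as the grid requires; the other half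
   bounds the grid step. *)
pose e' := e + eta / 2; pose eta' := eta / 2.
have eta'0 : 0 < eta' by rewrite divr_gt0.
have e'0 : 0 < e' by rewrite ltr_wpDl.
have ee' : e <= e' by rewrite lerDl ltW.
have one_sided (F' G' : functor (real_cat R) C) : tame F' -> tame G' ->
    interleaved e F' G' ->
    exists f, (forall q, diagram F' q -> diagram G' (f q) /\
      (point_dist q.1 (f q).1 <= (e + eta)%:E)%E) /\ {in diagram F' &, injective f}.
  move=> tF' tG' FG'.
  have [N [d [z [n [/andP[d0 deta] [edN N2n] fF fG margin]]]]] :=
    fine_grids_ex tF' tG' e'0 eta'0.
  have [m mC] := rank_lower_bounded C.
  have mK K : m <= @min_rank R C K.
    by have [[x [y [xy ->]]] _] := min_rankP K; rewrite (prankE _ xy).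
  have [phi [psi [psi_phi phi_psi]]] :=
    interleaved_le e0 ee' FG'.
  have match_cells := interp_cell_matching z (ltW d0) edN colims psi_phi phi_psi n mC.
  have [f [fP finj]] := one_sided_matching d0 edN N2n fF fG margin
    (mK F') (mK G') match_cells.
  exists f; split=> // q Fq; have [Gfq dq] := fP _ Fq; split=> //.
  by apply: le_trans dq _; rewrite lee_fin /e'; rewrite /eta' in deta; lra.
have [f [fP finj]] := one_sided _ _ tF tG FG.
have [g [gP ginj]] := one_sided _ _ tG tF (interleaved_sym FG).
apply: (@Cantor_Bernstein_pointwise _ _ _ f g
  (fun q q' => (point_dist q.1 q'.1 <= (e + eta)%:E)%E)) => // b /gP[? ?].
by rewrite point_dist_sym.
Qed.

Lemma bottleneck_dist_le (C : ranked_category)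
    (F G : functor (real_cat R) C) (e : R) :
  has_finite_colimits C -> tame F -> tame G -> 0 <= e -> interleaved e F G ->
  (bottleneck_dist F G <= e%:E)%E.
Proof.
move=> colims tF tG e0 FG; apply/lee_addgt0Pr => eta eta0.
have [beta [bij_beta betaP]] := bottleneck_bijection_ex colims tF tG e0 eta0 FG.
apply: (@le_trans _ _ (matching_cost fst (diagram F) beta)).
  by apply: ereal_inf_lbound; exists beta.
apply: ge_ereal_sup => _ [->|[q Fq <-]]; last exact: betaP.
by rewrite lee_fin addr_ge0// ltW.
Qed.

End Interleaved.

(** * Combining the colors *)

Section Colored.
Variables (R : realType) (Gamma : choiceType) (C : ranked_category).
Variables (Q : Gamma -> ranked_category) (c : coloring C Q).
Implicit Types F G : functor (real_cat R) C.

(** Writing the map from [x] to [y] as a composite with the identity at either end bounds its rank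
    in each color, so equality of total ranks passes to every color. *)
Lemma tame_color g F : tame F -> tame (fcomp (color c g) F).
Proof.
apply: sub_finite_set => a /=; apply: contra_not => -[I [nI cI constI]].
exists I; split=> // x y Ix Iy xy.
have [pxx pyy] := constI x y Ix Iy xy; move: pxx pyy.
rewrite !(prankE _ (lexx _)) !(prankE _ xy) /=.
set fx := fmap F _; set fxy := fmap F _; set fy := fmap F _ => pxx pyy.
have fxyx : fxy \c fx = fxy by exact: fmap_real.
have fyxy : fy \c fxy = fxy by exact: fmap_real.
split; [symmetry|]; apply: (color_rank_image_le (c := c)) => // h.
  by rewrite -[X in fmap _ X]fxyx fmapM; exact: rank_image_compl.
by rewrite -[X in fmap _ X]fyxy fmapM; exact: rank_image_compr.
Qed.

Lemma color_natural g e (K L : functor (real_cat R) C)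
    (t : nat_trans K (fcomp L (shift e))) (a b : real_cat R) (h : hom a b) :
  @fmap _ _ (fcomp (fcomp (color c g) L) (shift e)) a b h \c fmap (color c g) (t a) =
  fmap (color c g) (t b) \c @fmap _ _ (fcomp (color c g) K) a b h.
Proof.
by have := congr1 (@fmap _ _ (color c g) _ _) (ncompP t h); rewrite !fmapM.
Qed.

Lemma interleaved_color g e F G : interleaved e F G ->
  interleaved e (fcomp (color c g) F) (fcomp (color c g) G).
Proof.
move=> [phi [psi [psi_phi phi_psi]]].
pose color_trans (K L : functor (real_cat R) C) (t : nat_trans K (fcomp L (shift e))) :=
  @NatTrans _ _ (fcomp (color c g) K) (fcomp (fcomp (color c g) L) (shift e))
    (fun a => fmap (color c g) (t a)) (color_natural g t).
exists (color_trans _ _ phi), (color_trans _ _ psi).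
by split=> a h /=; rewrite -fmapM ?psi_phi ?phi_psi.
Qed.

(** Fullness lifts the families of components to [C]; faithfulness lifts naturality and the
    interleaving identities, which hold in every color. *)
Lemma interleaved_of_colors e F G :
  (forall g, interleaved e (fcomp (color c g) F) (fcomp (color c g) G)) ->
  interleaved e F G.
Proof.
move=> FG; have ff := color_fully_faithful c.
have inv (X Y : C) : exists k : (forall g, hom (color c g X) (color c g Y)) -> hom X Y,
    forall u g, fmap (color c g) (k u) = u g.
  have [k _ kK] := ff X Y; exists k => u g.
  by have /(congr1 (fun v => v g)) := kK u.
have inj (X Y : C) (u v : hom X Y) :
    (forall g, fmap (color c g) u = fmap (color c g) v) -> u = v.
  move=> uv; apply: (bij_inj (ff X Y)).
  by apply: functional_extensionality_dep => g; exact: uv.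
pose lift X Y := sval (cid (inv X Y)).
have liftP X Y u g : fmap (color c g) (lift X Y u) = u g.
  exact: (svalP (cid (inv X Y)) u g).
pose phi g := sval (cid (FG g)).
pose psi g := sval (cid (svalP (cid (FG g)))).
have psi_phi g (a : R) (h : a <= a + e + e) : psi g (a + e) \c phi g a =
    @fmap _ _ (fcomp (color c g) F) a (a + e + e) h.
  exact: (svalP (cid (svalP (cid (FG g))))).1.
have phi_psi g (a : R) (h : a <= a + e + e) : phi g (a + e) \c psi g a =
    @fmap _ _ (fcomp (color c g) G) a (a + e + e) h.
  exact: (svalP (cid (svalP (cid (FG g))))).2.
have nat_lift (K L : functor (real_cat R) C) (t : forall g,
      nat_trans (fcomp (color c g) K) (fcomp (fcomp (color c g) L) (shift e)))
    (a b : real_cat R) (h : hom a b) :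
    @fmap _ _ (fcomp L (shift e)) a b h \c lift (K a) (L (a + e)) (fun g => t g a) =
    lift (K b) (L (b + e)) (fun g => t g b) \c @fmap _ _ K a b h.
  by apply: inj => g; rewrite !fmapM !liftP; exact: (ncompP (t g) h).
pose lift_trans K L (t : forall g,
    nat_trans (fcomp (color c g) K) (fcomp (fcomp (color c g) L) (shift e))) :=
  @NatTrans _ _ K (fcomp L (shift e))
  (fun a => lift (K a) (L (a + e)) (fun g => t g a)) (nat_lift K L t).
exists (lift_trans _ _ phi), (lift_trans _ _ psi).
by split=> a h; apply: inj => g /=; rewrite fmapM !liftP ?psi_phi ?phi_psi.
Qed.

(** Near-optimal bijections, one chosen for each color with the same slack [eta], are glued into one
    that preserves colors. *)
Lemma multi_bottleneck_dist_le F G (e : R) : 0 <= e ->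
  (forall g, (bottleneck_dist (fcomp (color c g) F) (fcomp (color c g) G) <= e%:E)%E) ->
  (multi_bottleneck_dist c F G <= e%:E)%E.
Proof.
move=> e0 dle; apply/lee_addgt0Pr => eta eta0.
have ex_beta g : exists beta, set_bij (diagram (fcomp (color c g) F))
      (diagram (fcomp (color c g) G)) beta /\
    (matching_cost fst (diagram (fcomp (color c g) F)) beta <= (e + eta)%:E)%E.
  have /ereal_inf_lt[_ [beta bij_beta <-] cost] :
      (bottleneck_dist (fcomp (color c g) F) (fcomp (color c g) G) < (e + eta)%:E)%E.
    by rewrite (le_lt_trans (dle g))// lte_fin ltrDl.
  by exists beta; split=> //; exact: ltW.
have [b bP] := choice ex_beta.
pose beta (q : Gamma * (\bar R * \bar R * nat)) := (q.1, b q.1 q.2).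
apply: (@le_trans _ _ (matching_cost (fun q => q.2.1) (multidiagram c F) beta)).
  apply: ereal_inf_lbound; exists beta => //; split=> //; split.
  - by move=> [g q] /= Fq; have [[bfun _ _] _] := bP g; exact: bfun.
  - move=> [g q] [g' q'] /set_mem /= Fq /set_mem /= Fq' [gg'].
    rewrite -gg' in Fq' *; have [[_ binj _] _] := bP g.
    by move=> /binj ->//; exact/mem_set.
  - move=> [g q] /= Gq; have [[_ _ bsurj] _] := bP g.
    by have [q' Fq' <-] := bsurj q Gq; exists (g, q').
apply: ge_ereal_sup => _ [->|[[g q] /= Fq <-]].
  by rewrite lee_fin addr_ge0// ltW.
apply: le_trans (bP g).2; apply: ereal_sup_ubound; right; exists q => //.
Qed.

Lemma bottleneck_dist_color_le F G beta g :
  set_bij (multidiagram c F) (multidiagram c G) beta ->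
  (forall q, multidiagram c F q -> (beta q).1 = q.1) ->
  (bottleneck_dist (fcomp (color c g) F) (fcomp (color c g) G) <=
   matching_cost (fun q => q.2.1) (multidiagram c F) beta)%E.
Proof.
move=> [bfun binj bsurj] bcol.
pose b q := (beta (g, q)).2.
have bE q : diagram (fcomp (color c g) F) q -> beta (g, q) = (g, b q).
  by move=> Fq; rewrite [LHS]surjective_pairing (bcol (g, q) Fq).
apply: (@le_trans _ _ (matching_cost fst (diagram (fcomp (color c g) F)) b)).
  apply: ereal_inf_lbound; exists b => //; split.
  - by move=> q Fq; have := bfun (g, q) Fq; rewrite bE.
  - move=> q q' /set_mem Fq /set_mem Fq' bqq'.
    have : beta (g, q) = beta (g, q') by rewrite !bE// bqq'.
    by move=> /binj; rewrite !mem_set// => /(_ isT isT)[].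
  - move=> q Gq; have [[g' q'] Fq' bq'] := bsurj (g, q) Gq.
    have g'g : g' = g by have := bcol _ Fq'; rewrite bq'.
    rewrite g'g in Fq' bq'; exists q' => //.
    by rewrite /b bq'.
apply: ge_ereal_sup => _ [->|[q Fq <-]]; apply: ereal_sup_ubound; first by left.
by right; exists (g, q).
Qed.

End Colored.

Theorem theorem4 (R : realType) (Gamma : choiceType) (C : ranked_category)
    (Q : Gamma -> ranked_category) (c : coloring C Q) :
  ((forall g : Gamma, has_finite_colimits (Q g)) ->
   forall F G : functor (real_cat R) C, tame F -> tame G ->
     (multi_bottleneck_dist c F G <= interleaving_dist F G)%E) /\
  ((forall g : Gamma, tight R (Q g)) -> tight_coloring R c).
Proof.
split=> [colims|tightQ] F G tF tG.
  apply: le_ereal_inf_tmp => _ [e [e0 FG] <-].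
  apply: multi_bottleneck_dist_le => // g; apply: bottleneck_dist_le => //.
  - exact: tame_color.
  - exact: tame_color.
  - exact: interleaved_color.
have tightg g := tightQ g _ _ (tame_color c g tF) (tame_color c g tG).
apply/le_anti/andP; split; last first.
  apply: le_ereal_inf_tmp => _ [e [e0 FG] <-].
  apply: multi_bottleneck_dist_le => // g; rewrite -tightg.
  by apply: ereal_inf_lbound; exists e => //; split=> //; exact: interleaved_color.
apply: le_ereal_inf_tmp => _ [beta [bij_beta beta_color] <-].
set x := matching_cost _ _ _; rewrite leNgt; apply/negP => xlt.
have x0 : (0 <= x)%E by apply: ereal_sup_ubound; left.
(* A real number strictly above the cost of [beta], hence above the distance in every color, is one
   interleaving parameter that works for all colors at once. *)
have [y xy ylt] : exists2 y : R, (x < y%:E)%E & (y%:E < interleaving_dist F G)%E.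
  case: x x0 xlt => [x||]//; case: (interleaving_dist F G) => [t||]// x0 xt.
  - by rewrite lte_fin in xt; exists ((x + t) / 2); rewrite lte_fin; lra.
  - by exists (x + 1); rewrite ?ltry// lte_fin; lra.
have y0 : 0 <= y by rewrite -lee_fin (le_trans x0)// ltW.
move: ylt; rewrite ltNge => /negP; apply; apply: ereal_inf_lbound; exists y => //.
split=> //; apply: (@interleaved_of_colors _ _ _ _ c) => g.
have /ereal_inf_lt[_ [e [e0 FG] <-]] : (interleaving_dist (fcomp (color c g) F)
    (fcomp (color c g) G) < y%:E)%E.
  by rewrite tightg (le_lt_trans _ xy)//; exact: bottleneck_dist_color_le.
by rewrite lte_fin => /ltW ey; exact: interleaved_le FG.
Qed.
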